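(* Let $v,a,b,c\in\mathbb{C}$ with $\Re(v)<2$, $\Re(c)>0$, and $\Re(vc+a+b)>0$, $\Re(vc+a-b)>0$, $\Re(vc-a+b)>0$, $\Re(vc-a-b)>0$. Fix a square root $\sqrt{a^2+b^2}$ and put $\lambda_1=\frac v2-\frac{\sqrt{a^2+b^2}}{2c}$, $\lambda_2=\frac v2+\frac{\sqrt{a^2+b^2}}{2c}$, $\sigma_3=\frac v2-\frac{a}{2c}-\frac{b}{2c}$, $\sigma_4=\frac v2-\frac{a}{2c}+\frac{b}{2c}$, $\sigma_5=\frac v2+\frac{a}{2c}+\frac{b}{2c}$, $\sigma_6=\frac v2+\frac{a}{2c}-\frac{b}{2c}$, $P=(vc-a-b)(vc+a+b)(vc-a+b)(vc+a-b)$; assume $\frac v2,\lambda_1,\lambda_2\notin\mathbb{Z}_0^-$ and $1+\sigma_j\notin\mathbb{Z}_0^-$ ($j=3,4,5,6$). Then $$ \int_0^\infty\frac{\cosh(ax)\cosh(bx)}{\cosh^{v}(cx)}\,dx=\frac{2^{v}(v^3c^3-a^2vc-b^2vc)}{P}\;{}_8F_7\!\left(\begin{matrix}v,\ 1+\frac v2,\ 1+\lambda_1,\ 1+\lambda_2,\ \sigma_3,\ \sigma_4,\ \sigma_5,\ \sigma_6\\ \frac v2,\ \lambda_1,\ \lambda_2,\ 1+\sigma_3,\ 1+\sigma_4,\ 1+\sigma_5,\ 1+\sigma_6\end{matrix};\,-1\right). $$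
   Context: $\mathbb{Z}_0^-=\{0,-1,-2,\dots\}$. The Pochhammer symbol is $(\lambda)_0=1$, $(\lambda)_n=\lambda(\lambda+1)\cdots(\lambda+n-1)$ for $n\ge1$. The generalized hypergeometric series is ${}_pF_q\!\left(\begin{matrix}\alpha_1,\dots,\alpha_p\\ \beta_1,\dots,\beta_q\end{matrix};z\right)=\sum_{n=0}^\infty\frac{(\alpha_1)_n\cdots(\alpha_p)_n}{(\beta_1)_n\cdots(\beta_q)_n}\frac{z^n}{n!}$ (with no $\beta_j\in\mathbb{Z}_0^-$); when $p=q+1$ and $z=-1$ it converges if $\Re(\sum\beta_j-\sum\alpha_i)>-1$. For $\Re(c)>0$ and $x>0$, the complex power $\cosh^{v}(cx)$ means $2^{-v}e^{vcx}(1+e^{-2cx})^{v}$, with the principal branch of $(1+e^{-2cx})^{v}$ (this agrees with the ordinary real power when $c>0$ and $v$ is real). *)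

(* Defs.v *)
From Stdlib Require Import Reals Lra List Factorial.
Open Scope R_scope.

Record Cplx := mkC { Re : R; Im : R }.

Definition RtoC (x : R) : Cplx := mkC x 0.
Definition Czero : Cplx := RtoC 0.
Definition Cone : Cplx := RtoC 1.
Definition Cadd (z w : Cplx) : Cplx := mkC (Re z + Re w) (Im z + Im w).
Definition Copp (z : Cplx) : Cplx := mkC (- Re z) (- Im z).
Definition Csub (z w : Cplx) : Cplx := Cadd z (Copp w).
Definition Cmul (z w : Cplx) : Cplx :=
  mkC (Re z * Re w - Im z * Im w) (Re z * Im w + Im z * Re w).
Definition Cnorm2 (z : Cplx) : R := Re z * Re z + Im z * Im z.
Definition Cnorm (z : Cplx) : R := sqrt (Cnorm2 z).
Definition Cinv (z : Cplx) : Cplx := mkC (Re z / Cnorm2 z) (- Im z / Cnorm2 z).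
Definition Cdiv (z w : Cplx) : Cplx := Cmul z (Cinv w).
Fixpoint Cpown (z : Cplx) (n : nat) : Cplx :=
  match n with O => Cone | S k => Cmul (Cpown z k) z end.

Definition Cexp (z : Cplx) : Cplx := mkC (exp (Re z) * cos (Im z)) (exp (Re z) * sin (Im z)).

(** Principal argument in (-PI, PI] (atan2), and principal logarithm. *)
Definition Carg (z : Cplx) : R :=
  let x := Re z in let y := Im z in
  match Rlt_dec 0 x with
  | left _ => atan (y / x)
  | right _ =>
    match Rlt_dec x 0 with
    | left _ => match Rle_dec 0 y with
                | left _ => atan (y / x) + PI
                | right _ => atan (y / x) - PI end
    | right _ => match Rlt_dec 0 y with
                 | left _ => PI / 2
                 | right _ => match Rlt_dec y 0 with
                              | left _ => - (PI / 2)
                              | right _ => 0 end end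
    end
  end.
Definition Clog (z : Cplx) : Cplx := mkC (ln (Cnorm z)) (Carg z).

Definition Cpow (z w : Cplx) : Cplx := Cexp (Cmul w (Clog z)).

Definition Ccosh (z : Cplx) : Cplx := Cdiv (Cadd (Cexp z) (Cexp (Copp z))) (RtoC 2).

(** cosh^v(c x) := 2^{-v} e^{v c x} (1 + e^{-2 c x})^v (principal branch). *)
Definition cosh_pow (v c : Cplx) (x : R) : Cplx :=
  let cx := Cmul c (RtoC x) in
  Cmul (Cmul (Cexp (Copp (Cmul v (RtoC (ln 2))))) (Cexp (Cmul v cx)))
       (Cpow (Cadd Cone (Cexp (Copp (Cmul (RtoC 2) cx)))) v).

Definition two_pow (v : Cplx) : Cplx := Cexp (Cmul v (RtoC (ln 2))).

Definition not_nonpos_int (z : Cplx) : Prop := forall n : nat, z <> RtoC (- INR n).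

Fixpoint poch (z : Cplx) (n : nat) : Cplx :=
  match n with O => Cone | S k => Cmul (poch z k) (Cadd z (RtoC (INR k))) end.

Definition poch_prod (l : list Cplx) (n : nat) : Cplx :=
  fold_right (fun a acc => Cmul (poch a n) acc) Cone l.

Definition hyp_term (alphas betas : list Cplx) (z : Cplx) (n : nat) : Cplx :=
  Cdiv (Cmul (poch_prod alphas n) (Cpown z n))
       (Cmul (poch_prod betas n) (RtoC (INR (fact n)))).

Fixpoint hyp_partial (alphas betas : list Cplx) (z : Cplx) (N : nat) : Cplx :=
  match N with
  | O => hyp_term alphas betas z O
  | S k => Cadd (hyp_partial alphas betas z k) (hyp_term alphas betas z (S k))
  end.

Definition hyp_series_sum (alphas betas : list Cplx) (z S : Cplx) : Prop :=
  forall eps, 0 < eps -> exists N : nat, forall n : nat, (n >= N)%nat ->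
    Cnorm (Csub (hyp_partial alphas betas z n) S) < eps.

Definition improper_int_R (g : R -> R) (L : R) : Prop :=
  (forall T : R, 0 <= T -> inhabited (Riemann_integrable g 0 T)) /\
  (forall eps, 0 < eps -> exists M : R, forall T : R, M <= T ->
     forall pr : Riemann_integrable g 0 T, Rabs (RiemannInt pr - L) < eps).

Definition improper_int_C (f : R -> Cplx) (L : Cplx) : Prop :=
  improper_int_R (fun x => Re (f x)) (Re L) /\
  improper_int_R (fun x => Im (f x)) (Im L).

(* Main.v *)
(** Put w = e^(-2cx) and c_n = (v)_n (-1)^n / n!, so that the integrand is
    2^v / 4 times (1 + w)^(-v) times the sum of e^(-mu x) over the four values
    mu = vc +- a +- b.  Let P_N be the N-th partial sum of the binomial series.
    The derivative of (1 + tw)^v P_N(tw) in t is a single term,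
    (v + N) c_N t^N w^(N+1) (1 + tw)^(v-1), and 1 + w stays in a half-plane
    Re >= d > 0 for x >= 0; hence (1 + w)^(-v) - P_N(w) is bounded by a constant
    times |c_(N+1)| e^(-2 Re(c) (N+1) x).  Integrated over x this gives
    O(|c_(N+1)| / (N+1)), which tends to 0 exactly because Re v < 2.  So
    term-by-term integration is legitimate without absolute convergence, and it
    yields the series of c_n times the sum of 1 / (mu + 2cn), whose terms are
    those of the 8F7 series by partial fractions. *)
From Coquelicot Require Import Coquelicot.
Require Import Defs.
From Stdlib Require Import Reals List Factorial Lra Lia Field.
Import ListNotations.
Open Scope R_scope.

(* Complex arithmetic: field structure, modulus, exponential, principal powers *)
Declare Scope cplx_scope.
Delimit Scope cplx_scope with X.
Bind Scope cplx_scope with Cplx.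
Local Notation "x + y" := (Cadd x y) : cplx_scope.
Local Notation "x - y" := (Csub x y) : cplx_scope.
Local Notation "x * y" := (Cmul x y) : cplx_scope.
Local Notation "x / y" := (Cdiv x y) : cplx_scope.
Local Notation "- x" := (Copp x) : cplx_scope.
Local Notation "/ x" := (Cinv x) : cplx_scope.

Lemma Cplx_ext (z w : Cplx) : Re z = Re w -> Im z = Im w -> z = w.
Proof. destruct z, w; simpl; intros -> ->; reflexivity. Qed.

Lemma Cnorm2_neq0 (z : Cplx) : z <> Czero -> Cnorm2 z <> 0.
Proof.
  intros Hz H0; apply Hz; unfold Cnorm2 in H0.
  apply Cplx_ext; simpl; nra.
Qed.

Lemma Cplx_field_theory :
  field_theory Czero Cone Cadd Cmul Csub Copp Cdiv Cinv (@eq Cplx).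
Proof.
  constructor.
  - constructor; intros; try reflexivity; apply Cplx_ext; simpl; ring.
  - intros H; injection H; lra.
  - reflexivity.
  - intros z Hz; pose proof (Cnorm2_neq0 z Hz) as H.
    apply Cplx_ext; simpl; unfold Cnorm2 in *; field; exact H.
Qed.
Add Field Cplx_field : Cplx_field_theory.

Lemma RtoC_plus (x y : R) : RtoC (x + y) = (RtoC x + RtoC y)%X.
Proof. apply Cplx_ext; simpl; ring. Qed.

Lemma RtoC_neq0 (x : R) : x <> 0 -> RtoC x <> Czero.
Proof. intros H H'; injection H'; exact H. Qed.

Lemma RtoC_2 : RtoC 2 = (Cone + Cone)%X.
Proof. apply Cplx_ext; simpl; ring. Qed.

Lemma Re_pos_neq0 (z : Cplx) : 0 < Re z -> z <> Czero.
Proof. intros H ->; simpl in H; lra. Qed.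

Lemma Cmul_neq0 (z w : Cplx) : z <> Czero -> w <> Czero -> (z * w)%X <> Czero.
Proof.
  intros Hz Hw H; apply Hw.
  replace w with (/ z * (z * w))%X by (field; exact Hz).
  rewrite H; ring.
Qed.

(** Lets multiplicativity and the triangle inequality be taken over from [Cmod]. *)
Lemma Cnorm_Cmod (z : Cplx) : Cnorm z = Cmod (Re z, Im z).
Proof. unfold Cnorm, Cnorm2, Cmod; simpl; f_equal; ring. Qed.

Lemma Cnorm_mul (z w : Cplx) : Cnorm (z * w)%X = Cnorm z * Cnorm w.
Proof. rewrite !Cnorm_Cmod, <- Cmod_mult; reflexivity. Qed.

Lemma Cnorm_triangle (z w : Cplx) : Cnorm (z + w)%X <= Cnorm z + Cnorm w.
Proof. rewrite !Cnorm_Cmod; apply (Cmod_triangle (Re z, Im z) (Re w, Im w)). Qed.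

Lemma Cnorm_ge0 (z : Cplx) : 0 <= Cnorm z.
Proof. apply sqrt_pos. Qed.

Lemma Cnorm_RtoC (x : R) : Cnorm (RtoC x) = Rabs x.
Proof.
  unfold Cnorm, Cnorm2; simpl.
  replace (x * x + 0 * 0) with (Rsqr x) by (unfold Rsqr; ring).
  apply sqrt_Rsqr_abs.
Qed.

Lemma Cnorm_opp (z : Cplx) : Cnorm (- z)%X = Cnorm z.
Proof. unfold Cnorm, Cnorm2; simpl; f_equal; ring. Qed.

Lemma Re_le_Cnorm (z : Cplx) : Rabs (Re z) <= Cnorm z.
Proof.
  rewrite <- sqrt_Rsqr_abs; apply sqrt_le_1_alt; unfold Cnorm2, Rsqr; nra.
Qed.

Lemma Im_le_Cnorm (z : Cplx) : Rabs (Im z) <= Cnorm z.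
Proof.
  rewrite <- sqrt_Rsqr_abs; apply sqrt_le_1_alt; unfold Cnorm2, Rsqr; nra.
Qed.

Lemma Cnorm_le_abs (z : Cplx) : Cnorm z <= Rabs (Re z) + Rabs (Im z).
Proof.
  replace z with (RtoC (Re z) + mkC 0 1 * RtoC (Im z))%X
    at 1 by (apply Cplx_ext; simpl; ring).
  eapply Rle_trans; [apply Cnorm_triangle|].
  rewrite Cnorm_mul, !Cnorm_RtoC.
  replace (Cnorm (mkC 0 1)) with 1; [lra|].
  unfold Cnorm, Cnorm2; simpl.
  replace (0 * 0 + 1 * 1) with 1 by ring; now rewrite sqrt_1.
Qed.

Lemma Cnorm_pos (z : Cplx) : z <> Czero -> 0 < Cnorm z.
Proof.
  intros H; apply sqrt_lt_R0; pose proof (Cnorm2_neq0 z H).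
  unfold Cnorm2 in *; nra.
Qed.

Lemma Cnorm_one : Cnorm Cone = 1.
Proof. unfold Cone; rewrite Cnorm_RtoC; apply Rabs_R1. Qed.

Lemma Cnorm_inv (z : Cplx) : z <> Czero -> Cnorm (/ z)%X = / Cnorm z.
Proof.
  intros H; pose proof (Cnorm_pos z H).
  apply Rmult_eq_reg_l with (Cnorm z); [|lra].
  rewrite <- Cnorm_mul, Rinv_r by lra.
  replace (z * / z)%X with Cone by (field; exact H).
  exact Cnorm_one.
Qed.

Lemma Cnorm_pown (z : Cplx) (n : nat) : Cnorm (Cpown z n) = Cnorm z ^ n.
Proof.
  induction n as [|n IH]; simpl; [exact Cnorm_one|].
  rewrite Cnorm_mul, IH; ring.
Qed.

Lemma Cexp_add (z w : Cplx) : Cexp (z + w)%X = (Cexp z * Cexp w)%X.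
Proof.
  apply Cplx_ext; simpl; rewrite exp_plus, ?cos_plus, ?sin_plus; ring.
Qed.

Lemma Cexp_zero : Cexp Czero = Cone.
Proof. apply Cplx_ext; simpl; rewrite exp_0, ?cos_0, ?sin_0; ring. Qed.

Lemma Cnorm_exp (z : Cplx) : Cnorm (Cexp z) = exp (Re z).
Proof.
  unfold Cnorm, Cnorm2; simpl.
  replace (_ + _) with (Rsqr (exp (Re z))).
  - apply sqrt_Rsqr; left; apply exp_pos.
  - pose proof (sin2_cos2 (Im z)) as H; unfold Rsqr in *.
    rewrite <- (Rmult_1_r (exp (Re z) * exp (Re z))), <- H; ring.
Qed.

Lemma Cexp_neq0 (z : Cplx) : Cexp z <> Czero.
Proof.
  intros H; pose proof (Cnorm_exp z) as Hn; pose proof (exp_pos (Re z)).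
  rewrite H in Hn; unfold Czero in Hn; rewrite Cnorm_RtoC, Rabs_R0 in Hn; lra.
Qed.

Lemma Cexp_opp (z : Cplx) : Cexp (- z)%X = (/ Cexp z)%X.
Proof.
  assert (H : (Cexp z * Cexp (- z))%X = Cone).
  { rewrite <- Cexp_add; replace (z + - z)%X with Czero by ring; exact Cexp_zero. }
  replace (/ Cexp z)%X with (/ Cexp z * (Cexp z * Cexp (- z)))%X
    by (rewrite H; ring).
  field; apply Cexp_neq0.
Qed.

Lemma Cpow_opp (z u : Cplx) : Cpow z (- u)%X = (/ Cpow z u)%X.
Proof.
  unfold Cpow; rewrite <- Cexp_opp; f_equal; ring.
Qed.

(** Every logarithm below is taken in the right half-plane, where the case analysis of [Carg]
    collapses to a smooth expression. *)
Lemma Carg_right (z : Cplx) : 0 < Re z -> Carg z = atan (Im z / Re z).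
Proof. intros H; unfold Carg; destruct (Rlt_dec 0 (Re z)); [easy|lra]. Qed.

(** The modulus of z^u is exp(Re u ln|z| - Im u Arg z). Here |z| lies between d and 2, and |Arg z| <
    pi/2 <= 2, so the bound is uniform in z. *)
Lemma Cnorm_Cpow_le (u z : Cplx) (d : R) :
  0 < d -> d <= Re z -> Cnorm z <= 2 ->
  Cnorm (Cpow z u) <=
    exp (Rabs (Re u) * (Rabs (ln d) + Rabs (ln 2)) + Rabs (Im u) * 2).
Proof.
  intros Hd Hz H2; unfold Cpow; rewrite Cnorm_exp; simpl.
  assert (Ha : Rabs (Carg z) <= 2).
  { rewrite Carg_right by lra.
    pose proof (atan_bound (Im z / Re z)); pose proof PI_4.
    apply Rabs_le; lra. }
  assert (Hl : Rabs (ln (Cnorm z)) <= Rabs (ln d) + Rabs (ln 2)).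
  { pose proof (Re_le_Cnorm z) as H; rewrite Rabs_pos_eq in H by lra.
    assert (H3 : ln d <= ln (Cnorm z)) by (apply ln_le; lra).
    assert (H4 : ln (Cnorm z) <= ln 2) by (apply ln_le; lra).
    apply Rabs_le.
    pose proof (Rle_abs (ln 2)); pose proof (Rle_abs (- ln d)).
    rewrite Rabs_Ropp in H1; pose proof (Rabs_pos (ln d));
      pose proof (Rabs_pos (ln 2)); lra. }
  assert (Hle : forall x y, x <= y -> exp x <= exp y).
  { intros x y [H| ->]; [left; now apply exp_increasing|lra]. }
  apply Hle.
  eapply Rle_trans; [apply Rle_abs|].
  eapply Rle_trans; [apply Rabs_triang|].
  rewrite Rabs_Ropp, !Rabs_mult.
  apply Rplus_le_compat; apply Rmult_le_compat_l; try apply Rabs_pos; assumption.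
Qed.

(** * Derivatives of complex-valued functions of a real variable *)

Definition Cderiv (f : R -> Cplx) (x : R) (l : Cplx) : Prop :=
  is_derive (fun t => Re (f t)) x (Re l) /\ is_derive (fun t => Im (f t)) x (Im l).

Lemma Cderiv_const (z : Cplx) (x : R) : Cderiv (fun _ => z) x Czero.
Proof. split; apply is_derive_Reals, derivable_pt_lim_const. Qed.

Lemma Cderiv_RtoC (x : R) : Cderiv RtoC x Cone.
Proof. split; simpl; auto_derive; trivial. Qed.

Lemma Cderiv_add (f g : R -> Cplx) (x : R) (l m : Cplx) :
  Cderiv f x l -> Cderiv g x m -> Cderiv (fun t => f t + g t)%X x (l + m)%X.
Proof.
  intros [H1 H2] [H3 H4].
  split; [exact (is_derive_plus _ _ _ _ _ H1 H3)|exact (is_derive_plus _ _ _ _ _ H2 H4)].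
Qed.

Lemma Cderiv_mul (f g : R -> Cplx) (x : R) (l m : Cplx) :
  Cderiv f x l -> Cderiv g x m ->
  Cderiv (fun t => f t * g t)%X x (l * g x + f x * m)%X.
Proof.
  intros [H1 H2] [H3 H4].
  assert (D : forall p q p' q', is_derive p x p' -> is_derive q x q' ->
    is_derive (fun t => p t * q t) x (p' * q x + p x * q'))
    by (intros; apply (is_derive_mult p q); trivial; intros; apply Rmult_comm).
  split; simpl.
  - replace (_ + _) with
      ((Re l * Re (g x) + Re (f x) * Re m) - (Im l * Im (g x) + Im (f x) * Im m))
      by ring.
    exact (is_derive_minus _ _ _ _ _ (D _ _ _ _ H1 H3) (D _ _ _ _ H2 H4)).
  - replace (_ + _) with
      ((Re l * Im (g x) + Re (f x) * Im m) + (Im l * Re (g x) + Im (f x) * Re m))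
      by ring.
    exact (is_derive_plus _ _ _ _ _ (D _ _ _ _ H1 H4) (D _ _ _ _ H2 H3)).
Qed.

Lemma Cderiv_scal (f : R -> Cplx) (x : R) (z l : Cplx) :
  Cderiv f x l -> Cderiv (fun t => z * f t)%X x (z * l)%X.
Proof.
  intros H.
  replace (z * l)%X with (Czero * f x + z * l)%X by ring.
  apply (Cderiv_mul (fun _ => z)); [apply Cderiv_const|exact H].
Qed.

Lemma Cderiv_exp (f : R -> Cplx) (x : R) (l : Cplx) :
  Cderiv f x l -> Cderiv (fun t => Cexp (f t)) x (l * Cexp (f x))%X.
Proof.
  intros [H1 H2].
  set (p := fun t => Re (f t)); set (q := fun t => Im (f t)).
  change (is_derive p x (Re l)) in H1; change (is_derive q x (Im l)) in H2.
  split; simpl.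
  - change (is_derive (fun t => exp (p t) * cos (q t)) x
      (Re l * (exp (p x) * cos (q x)) - Im l * (exp (p x) * sin (q x)))).
    auto_derive; [repeat split; eexists; eassumption|].
    change (fun t => p t) with p; change (fun t => q t) with q.
    rewrite (is_derive_unique _ _ _ H1), (is_derive_unique _ _ _ H2); ring.
  - change (is_derive (fun t => exp (p t) * sin (q t)) x
      (Re l * (exp (p x) * sin (q x)) + Im l * (exp (p x) * cos (q x)))).
    auto_derive; [repeat split; eexists; eassumption|].
    change (fun t => p t) with p; change (fun t => q t) with q.
    rewrite (is_derive_unique _ _ _ H1), (is_derive_unique _ _ _ H2); ring.
Qed.

Lemma Cderiv_log (f : R -> Cplx) (x : R) (l : Cplx) :
  0 < Re (f x) -> Cderiv f x l -> Cderiv (fun t => Clog (f t)) x (l / f x)%X.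
Proof.
  intros H0 [H1 H2].
  set (p := fun t => Re (f t)); set (q := fun t => Im (f t)).
  change (is_derive p x (Re l)) in H1; change (is_derive q x (Im l)) in H2.
  change (0 < p x) in H0.
  assert (Hn : 0 < p x * p x + q x * q x) by nra.
  assert (Hs : 0 < sqrt (p x * p x + q x * q x)) by now apply sqrt_lt_R0.
  split; simpl.
  - change (is_derive (fun t => ln (sqrt (p t * p t + q t * q t))) x
      (Re l * (p x / (p x * p x + q x * q x))
        - Im l * (- q x / (p x * p x + q x * q x)))).
    auto_derive; [repeat split; try (eexists; eassumption); assumption|].
    change (fun t => p t) with p; change (fun t => q t) with q.
    rewrite (is_derive_unique _ _ _ H1), (is_derive_unique _ _ _ H2).
    set (r := sqrt _) in *.
    assert (Hr : p x * p x + q x * q x = r * r) by (symmetry; apply sqrt_sqrt; lra).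
    rewrite Hr; field; lra.
  - change (is_derive (fun t => Carg (f t)) x
      (Re l * (- q x / (p x * p x + q x * q x))
        + Im l * (p x / (p x * p x + q x * q x)))).
    (* The argument is an arctangent only where the real part is positive; by continuity this holds
       in a neighbourhood of [x]. *)
    apply is_derive_ext_loc with (fun t => atan (q t / p t)).
    + assert (Hc : continuous p x)
        by (apply (ex_derive_continuous p); eexists; exact H1).
      assert (Hl : locally x (fun t => 0 < p t))
        by (apply (Hc (fun y => 0 < y)), open_gt; exact H0).
      revert Hl; apply filter_imp; intros t Ht.
      symmetry; now apply Carg_right.
    + auto_derive; [repeat split; try (eexists; eassumption); lra|].
      change (fun t => p t) with p; change (fun t => q t) with q.
      rewrite (is_derive_unique _ _ _ H1), (is_derive_unique _ _ _ H2).
      field; repeat split; nra.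
Qed.

(** * Partial sums of the binomial series *)

Fixpoint Csum (u : nat -> Cplx) (N : nat) : Cplx :=
  match N with O => u O | S k => (Csum u k + u (S k))%X end.

Lemma Csum_ext (u w : nat -> Cplx) (N : nat) :
  (forall n, u n = w n) -> Csum u N = Csum w N.
Proof. intros H; induction N as [|N IH]; simpl; rewrite ?IH, H; reflexivity. Qed.

Lemma Csum_scal (z : Cplx) (u : nat -> Cplx) (N : nat) :
  Csum (fun n => z * u n)%X N = (z * Csum u N)%X.
Proof. induction N as [|N IH]; simpl; [|rewrite IH]; ring. Qed.

Lemma Cderiv_sum (u : nat -> R -> Cplx) (d : nat -> Cplx) (x : R) (N : nat) :
  (forall n, Cderiv (u n) x (d n)) ->
  Cderiv (fun t => Csum (fun n => u n t) N) x (Csum d N).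
Proof.
  intros H; induction N as [|N IH]; simpl; [apply H|].
  now apply (Cderiv_add (fun t => Csum (fun n => u n t) N)).
Qed.

(** Matching on the exponent avoids a truncated n - 1 at n = 0. *)
Definition pow_deriv (z : Cplx) (n : nat) : Cplx :=
  match n with O => Czero | S m => (RtoC (INR (S m)) * Cpown z m)%X end.

Lemma Cderiv_pown (f : R -> Cplx) (x : R) (l : Cplx) (n : nat) :
  Cderiv f x l -> Cderiv (fun t => Cpown (f t) n) x (l * pow_deriv (f x) n)%X.
Proof.
  intros H; induction n as [|n IH].
  - simpl; replace (l * Czero)%X with Czero by ring; apply Cderiv_const.
  - replace (l * pow_deriv (f x) (S n))%X
      with (l * pow_deriv (f x) n * f x + Cpown (f x) n * l)%X.
    + exact (Cderiv_mul _ _ _ _ _ IH H).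
    + unfold pow_deriv; destruct n as [|n].
      * simpl; replace (RtoC 1) with Cone by reflexivity; ring.
      * rewrite (S_INR (S n)), RtoC_plus; simpl (Cpown _ (S n)).
        replace (RtoC 1) with Cone by reflexivity; ring.
Qed.

(* The coefficient of [w^n] in [(1 + w)^(-v)]. *)
Definition nbinom (v : Cplx) (n : nat) : Cplx :=
  (poch v n * Cpown (RtoC (-1)) n / RtoC (INR (fact n)))%X.

(** This recurrence drives both the telescoping in [nbinom_ode] and the growth estimate in
    [nbinom_little_o]. *)
Lemma nbinom_S (v : Cplx) (n : nat) :
  (RtoC (INR (S n)) * nbinom v (S n))%X = (- ((v + RtoC (INR n)) * nbinom v n))%X.
Proof.
  unfold nbinom; simpl poch; simpl Cpown.
  replace (INR (fact (S n))) with (INR (S n) * INR (fact n))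
    by (rewrite <- mult_INR; reflexivity).
  replace (RtoC (INR (S n) * INR (fact n)))
    with (RtoC (INR (S n)) * RtoC (INR (fact n)))%X
    by (apply Cplx_ext; simpl; ring).
  replace (RtoC (-1)) with (- Cone)%X by (apply Cplx_ext; simpl; ring).
  field; split; apply RtoC_neq0; [apply INR_fact_neq_0|apply not_0_INR; lia].
Qed.

(** The function f = (1 + z)^(-v) solves v f + (1 + z) f' = 0. For a partial sum, the recurrence
    cancels the coefficients of all powers below z^N, and only the top one survives. *)
Lemma nbinom_ode (v z : Cplx) (N : nat) :
  (v * Csum (fun n => nbinom v n * Cpown z n) N
    + (Cone + z) * Csum (fun n => nbinom v n * pow_deriv z n) N)%X
  = ((v + RtoC (INR N)) * nbinom v N * Cpown z N)%X.
Proof.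
  induction N as [|N IH].
  - simpl; replace (RtoC 0) with Czero by reflexivity; ring.
  - cbn [Csum Cpown pow_deriv].
    (* The new terms are split off: by [nbinom_S], the z^N part of the last one cancels the
       remainder left by the induction hypothesis. *)
    transitivity ((v * Csum (fun n => nbinom v n * Cpown z n) N
    + (Cone + z) * Csum (fun n => nbinom v n * pow_deriv z n) N)
      + v * nbinom v (S N) * Cpown z N * z
      + (Cone + z) * (RtoC (INR (S N)) * nbinom v (S N)) * Cpown z N)%X;
      [ring|].
    rewrite IH.
    replace ((v + RtoC (INR (S N))) * nbinom v (S N))%X
      with (v * nbinom v (S N) + RtoC (INR (S N)) * nbinom v (S N))%X by ring.
    rewrite nbinom_S; ring.
Qed.

(** * Mean value inequality and the binomial remainder *)

(** Both [h - g] and [h + g] have nonnegative derivative, so the mean value theorem makes each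
    nondecreasing. *)
Lemma derive_le_abs (g h : R -> R) (g' h' : R -> R) (a b : R) :
  a <= b ->
  (forall x, a <= x <= b -> is_derive g x (g' x)) ->
  (forall x, a <= x <= b -> is_derive h x (h' x)) ->
  (forall x, a <= x <= b -> Rabs (g' x) <= h' x) ->
  Rabs (g b - g a) <= h b - h a.
Proof.
  intros Hab Hg Hh Hle.
  assert (Hm : forall k k' : R -> R,
    (forall x, a <= x <= b -> is_derive k x (k' x)) ->
    (forall x, a <= x <= b -> 0 <= k' x) -> k a <= k b).
  { intros k k' Hk Hk'.
    destruct (MVT_gen k a b k') as [c [Hc Heq]].
    - rewrite Rmin_left, Rmax_right by lra; intros; apply Hk; lra.
    - rewrite Rmin_left, Rmax_right by lra; intros x Hx.
      apply continuity_pt_filterlim, (ex_derive_continuous k).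
      eexists; apply Hk, Hx.
    - rewrite Rmin_left, Rmax_right in Hc by lra.
      pose proof (Hk' c Hc); nra. }
  assert (H1 : (h a - g a) <= h b - g b).
  { apply (Hm (fun x => h x - g x) (fun x => h' x - g' x)).
    - intros x Hx; exact (is_derive_minus _ _ _ _ _ (Hh x Hx) (Hg x Hx)).
    - intros x Hx; pose proof (Rle_abs (g' x)); pose proof (Hle x Hx); lra. }
  assert (H2 : (h a + g a) <= h b + g b).
  { apply (Hm (fun x => h x + g x) (fun x => h' x + g' x)).
    - intros x Hx; exact (is_derive_plus _ _ _ _ _ (Hh x Hx) (Hg x Hx)).
    - intros x Hx; pose proof (Rle_abs (- g' x)); rewrite Rabs_Ropp in H.
      pose proof (Hle x Hx); lra. }
  apply Rabs_le; lra.
Qed.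

(** Real and imaginary parts are bounded separately, which costs the factor 2. *)
Lemma Cderiv_le_Cnorm (f : R -> Cplx) (f' : R -> Cplx) (h h' : R -> R) (a b : R) :
  a <= b ->
  (forall x, a <= x <= b -> Cderiv f x (f' x)) ->
  (forall x, a <= x <= b -> is_derive h x (h' x)) ->
  (forall x, a <= x <= b -> Cnorm (f' x) <= h' x) ->
  Cnorm (f b - f a)%X <= 2 * (h b - h a).
Proof.
  intros Hab Hf Hh Hle.
  eapply Rle_trans; [apply Cnorm_le_abs|].
  assert (H1 : Rabs (Re (f b) - Re (f a)) <= h b - h a).
  { apply (derive_le_abs (fun t => Re (f t)) h (fun t => Re (f' t)) h'); trivial.
    - intros x Hx; apply (Hf x Hx).
    - intros x Hx; eapply Rle_trans; [apply Re_le_Cnorm|now apply Hle]. }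
  assert (H2 : Rabs (Im (f b) - Im (f a)) <= h b - h a).
  { apply (derive_le_abs (fun t => Im (f t)) h (fun t => Im (f' t)) h'); trivial.
    - intros x Hx; apply (Hf x Hx).
    - intros x Hx; eapply Rle_trans; [apply Im_le_Cnorm|now apply Hle]. }
  unfold Csub; simpl in *; unfold Rminus in *; lra.
Qed.

(** Along the segment from 0 to w, G(t) = (1 + tw)^v P_N(tw) starts at 1 and by [nbinom_ode] has a
    one-term derivative. Bounding G(1) - 1 and multiplying by (1 + w)^(-v) gives the estimate, with
    K depending on v and d only. *)
Lemma binomial_remainder (v : Cplx) (d : R) :
  0 < d <= 1 -> exists K, 0 <= K /\
  forall w N, Cnorm w <= 1 -> d <= Re (Cone + w)%X ->
  Cnorm (Cpow (Cone + w) (- v) - Csum (fun n => nbinom v n * Cpown w n) N)%X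
    <= K * Cnorm (nbinom v (S N)) * Cnorm w ^ (S N).
Proof.
  intros Hd.
  set (B := fun u => exp (Rabs (Re u) * (Rabs (ln d) + Rabs (ln 2)) + Rabs (Im u) * 2)).
  assert (HB : forall u, 0 < B u) by (intros; apply exp_pos).
  (* The 2 comes from [Cderiv_le_Cnorm], [B v / d] bounds (1 + tw)^v / (1 + tw), and [B (- v)]
     bounds the final factor (1 + w)^(-v). *)
  exists (2 * B (- v)%X * (B v / d)); split.
  { pose proof (HB v); pose proof (HB (- v)%X).
    apply Rmult_le_pos; [lra|]; apply Rlt_le, Rdiv_lt_0_compat; lra. }
  intros w N Hw Hre.
  set (z := fun t => (w * RtoC t)%X).
  set (P := fun t => Csum (fun n => nbinom v n * Cpown (z t) n)%X N).
  set (G := fun t => (Cpow (Cone + z t) v * P t)%X).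
  (* By the recurrence this is -(v + N) c_N. In this form the factor N + 1 is absorbed when t^N is
     integrated, leaving c_(N+1). *)
  set (c' := (RtoC (INR (S N)) * nbinom v (S N))%X).
  (* 1 + tw is a convex combination of 1 and 1 + w, both of real part at least d since d <= 1. *)
  assert (Hpos : forall t, 0 <= t <= 1 -> d <= Re (Cone + z t)%X).
  { intros t Ht; simpl in *; nra. }
  assert (Hn2 : forall t, 0 <= t <= 1 -> Cnorm (Cone + z t)%X <= 2).
  { intros t Ht; eapply Rle_trans; [apply Cnorm_triangle|].
    rewrite Cnorm_one; unfold z; rewrite Cnorm_mul, Cnorm_RtoC, Rabs_pos_eq by lra.
    pose proof (Cnorm_ge0 w); nra. }
  assert (HG : forall t, 0 <= t <= 1 -> Cderiv G t
    (Cpow (Cone + z t) v * (w / (Cone + z t)) * (- c') * Cpown (z t) N)%X).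
  { intros t Ht; specialize (Hpos t Ht).
    assert (Hz : Cderiv z t w).
    { pose proof (Cderiv_scal RtoC t w Cone (Cderiv_RtoC t)) as H.
      replace (w * Cone)%X with w in H by ring; exact H. }
    assert (Hz1 : Cderiv (fun t => Cone + z t)%X t w).
    { pose proof (Cderiv_add _ _ _ _ _ (Cderiv_const Cone t) Hz) as H.
      replace (Czero + w)%X with w in H by ring; exact H. }
    assert (HP : Cderiv P t (w * Csum (fun n => nbinom v n * pow_deriv (z t) n) N)%X).
    { rewrite <- Csum_scal.
      apply (Cderiv_sum (fun n t => nbinom v n * Cpown (z t) n)%X); intros n.
      replace (w * (nbinom v n * pow_deriv (z t) n))%X
        with (nbinom v n * (w * pow_deriv (z t) n))%X by ring.
      apply (Cderiv_scal (fun t => Cpown (z t) n)), Cderiv_pown, Hz. }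
    assert (HQ : Cderiv (fun t => Cpow (Cone + z t)%X v) t
      (v * (w / (Cone + z t)) * Cpow (Cone + z t) v)%X).
    { apply (Cderiv_exp (fun t => v * Clog (Cone + z t))%X).
      apply Cderiv_scal, (Cderiv_log (fun t => Cone + z t)%X); [lra|exact Hz1]. }
    pose proof (Cderiv_mul _ _ _ _ _ HQ HP) as HG.
    match type of HG with Cderiv _ _ ?l => replace (_ * _)%X with l end; [exact HG|].
    unfold c'; rewrite nbinom_S.
    replace (- - ((v + RtoC (INR N)) * nbinom v N))%X
      with ((v + RtoC (INR N)) * nbinom v N)%X by ring.
    transitivity (Cpow (Cone + z t) v * (w / (Cone + z t))
      * ((v + RtoC (INR N)) * nbinom v N * Cpown (z t) N))%X; [|ring].
    rewrite <- nbinom_ode; fold (P t); field.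
    apply Re_pos_neq0, (Rlt_le_trans _ d); [lra|exact Hpos]. }
  assert (HG0 : G 0 = Cone).
  { unfold G, P, z.
    replace (w * RtoC 0)%X with Czero by (apply Cplx_ext; simpl; ring).
    replace (Cone + Czero)%X with Cone by ring.
    replace (Cpow Cone v) with Cone.
    - clear; induction N as [|N IH].
      + unfold Csum, nbinom; apply Cplx_ext; simpl; unfold Cnorm2; simpl; field.
      + cbn [Csum Cpown]; etransitivity; [|exact IH]; ring.
    - unfold Cpow; replace (Clog Cone) with Czero; [rewrite <- Cexp_zero; f_equal; ring|].
      unfold Clog; rewrite Cnorm_one, ln_1, Carg_right by (simpl; lra).
      simpl; replace (0 / 1) with 0 by field; now rewrite atan_0. }
  assert (HG1 : G 1 = (Cpow (Cone + w) v * Csum (fun n => nbinom v n * Cpown w n) N)%X).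
  { unfold G, P, z; replace (w * RtoC 1)%X with w; [reflexivity|].
    apply Cplx_ext; simpl; ring. }
  (* M t^(N+1) is the majorant: its derivative M (N+1) t^N dominates the modulus of G'. *)
  set (M := B v / d * Cnorm (nbinom v (S N)) * Cnorm w ^ S N).
  assert (Hbd : Cnorm (G 1 - G 0)%X <= 2 * (M * 1 ^ S N - M * 0 ^ S N)).
  { apply (Cderiv_le_Cnorm G _ (fun t => M * t ^ S N)
      (fun t => M * (INR (S N) * t ^ N))) with (2 := HG).
    - lra.
    - intros t _; auto_derive; [trivial|]; rewrite Rmult_1_l; reflexivity.
    - intros t Ht; rewrite !Cnorm_mul.
      unfold Cdiv; rewrite Cnorm_mul, Cnorm_opp, Cnorm_inv, Cnorm_pown
        by (apply Re_pos_neq0; specialize (Hpos t Ht); lra).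
      unfold c', z; rewrite !Cnorm_mul, !Cnorm_RtoC; fold (z t).
      rewrite (Rabs_pos_eq (INR _)) by apply pos_INR.
      rewrite (Rabs_pos_eq t), Rpow_mult_distr by lra.
      unfold M; simpl pow.
      assert (H1 : Cnorm (Cpow (Cone + z t)%X v) <= B v)
        by (apply Cnorm_Cpow_le; auto; lra).
      assert (H2 : / Cnorm (Cone + z t)%X <= / d).
      { apply Rinv_le_contravar; [lra|].
        pose proof (Re_le_Cnorm (Cone + z t)%X) as H; specialize (Hpos t Ht).
        rewrite Rabs_pos_eq in H; lra. }
      assert (H3 : 0 < / Cnorm (Cone + z t)%X).
      { apply Rinv_0_lt_compat, Cnorm_pos, Re_pos_neq0; specialize (Hpos t Ht); lra. }
      set (X := Cnorm w * (INR (S N) * Cnorm (nbinom v (S N))) * (Cnorm w ^ N * t ^ N)).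
      assert (HX : 0 <= X).
      { unfold X; repeat apply Rmult_le_pos; try apply Cnorm_ge0; try apply pos_INR;
          apply pow_le; [apply Cnorm_ge0|lra]. }
      replace (_ <= _) with
        (Cnorm (Cpow (Cone + z t)%X v) * / Cnorm (Cone + z t)%X * X <= B v * / d * X)
        by (unfold X; f_equal; unfold Rdiv; ring).
      apply Rmult_le_compat_r; [exact HX|].
      apply Rmult_le_compat; try lra; apply Cnorm_ge0. }
  rewrite HG0, HG1, pow1, pow_i in Hbd by lia.
  assert (Hw2 : Cnorm (Cone + w)%X <= 2).
  { eapply Rle_trans; [apply Cnorm_triangle|]; rewrite Cnorm_one; lra. }
  set (Q := Csum _ N) in *.
  (* Factoring out (1 + w)^(-v) leaves -(G(1) - G(0)). *)
  replace (Cpow (Cone + w) (- v) - Q)%X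
    with (Cpow (Cone + w) (- v) * - (Cpow (Cone + w) v * Q - Cone))%X.
  - rewrite Cnorm_mul, Cnorm_opp.
    replace (_ * _ * _) with (B (- v)%X * (2 * (M * 1 - M * 0)))
      by (unfold M; simpl; ring).
    apply Rmult_le_compat; try apply Cnorm_ge0; [|exact Hbd].
    apply Cnorm_Cpow_le; lra.
  - rewrite Cpow_opp; field; apply Cexp_neq0.
Qed.

(** * Decay of the binomial coefficients *)

(* Bernoulli's inequality makes [(n + q) * x n ^ m] nonincreasing once
   [m * (p - q) >= 1]. *)
Lemma Un_cv_0_of_ratio (x : nat -> R) (p q : R) (n0 : nat) :
  0 < q < p -> (forall n, 0 <= x n) ->
  (forall n, (n0 <= n)%nat -> x (S n) * (INR n + p) <= x n * (INR n + q)) ->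
  Un_cv x 0.
Proof.
  intros Hq Hx Hr.
  destruct (INR_unbounded (/ (p - q))) as [m Hm].
  assert (Hmh : 1 <= INR m * (p - q)).
  { replace 1 with (/ (p - q) * (p - q)) by (field; lra).
    apply Rmult_le_compat_r; lra. }
  assert (Hstep : forall n, (n0 <= n)%nat ->
    x (S n) ^ m * (INR (S n) + q) <= x n ^ m * (INR n + q)).
  { intros n Hn; specialize (Hr n Hn); pose proof (pos_INR n).
    (* Chosen so that (n + p) / (n + q) = 1 + r; [poly] below is Bernoulli's inequality (1 + r)^m >=
       1 + m r. *)
    set (r := (p - q) / (INR n + q)).
    assert (Hrpos : 0 < r) by (apply Rdiv_lt_0_compat; lra).
    assert (H1 : x (S n) * (1 + r) <= x n).
    { apply Rmult_le_reg_r with (INR n + q); [lra|].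
      replace (x (S n) * (1 + r) * (INR n + q)) with (x (S n) * (INR n + p))
        by (unfold r; field; lra); exact Hr. }
    assert (H2 : (x (S n) * (1 + r)) ^ m <= x n ^ m).
    { apply pow_incr; split; [|exact H1].
      apply Rmult_le_pos; [apply Hx|lra]. }
    rewrite Rpow_mult_distr in H2.
    pose proof (poly m r Hrpos) as H3.
    pose proof (pow_le (x (S n)) m (Hx (S n))) as H4.
    rewrite S_INR.
    assert (H5 : INR n + 1 + q <= (1 + r) ^ m * (INR n + q)).
    { apply Rle_trans with ((1 + INR m * r) * (INR n + q)).
      - replace ((1 + INR m * r) * (INR n + q))
          with (INR n + q + INR m * (p - q)) by (unfold r; field; lra); lra.
      - apply Rmult_le_compat_r; lra. }
    apply Rle_trans with (x (S n) ^ m * ((1 + r) ^ m * (INR n + q))).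
    - now apply Rmult_le_compat_l.
    - rewrite <- Rmult_assoc; apply Rmult_le_compat_r; lra. }
  set (C := x n0 ^ m * (INR n0 + q)).
  assert (HC : forall k, x (n0 + k)%nat ^ m * (INR (n0 + k) + q) <= C).
  { induction k as [|k IH].
    - rewrite Nat.add_0_r; apply Rle_refl.
    - rewrite Nat.add_succ_r; eapply Rle_trans; [apply Hstep; lia|exact IH]. }
  intros eps Heps.
  pose proof (pow_lt eps m Heps) as Hem.
  (* From (n + q) x_n^m <= C, a value x_n >= eps would force n eps^m <= C, which fails for n >=
     N. *)
  destruct (INR_unbounded (C / eps ^ m)) as [N HN].
  exists (n0 + N)%nat; intros n Hn.
  unfold Rdist; rewrite Rminus_0_r, Rabs_pos_eq by apply Hx.
  destruct (Rlt_or_le (x n) eps) as [|Hge]; [assumption|exfalso].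
  assert (H1 : eps ^ m <= x n ^ m) by (apply pow_incr; lra).
  specialize (HC (n - n0)%nat).
  replace (n0 + (n - n0))%nat with n in HC by lia.
  assert (H2 : INR N <= INR n) by (apply le_INR; lia).
  assert (H3 : C < INR N * eps ^ m).
  { replace C with (C / eps ^ m * eps ^ m) by (field; lra).
    apply Rmult_lt_compat_r; lra. }
  pose proof (pos_INR N).
  assert (INR N * eps ^ m <= x n ^ m * (INR n + q)).
  { rewrite (Rmult_comm (x n ^ m)); apply Rmult_le_compat; lra. }
  lra.
Qed.

(** With x_n = |c_n| / (n + 1) the recurrence reads (n + 2) x_(n+1) = |v + n| x_n. Since |v + n| is
    eventually at most n + q for any q > Re v, the condition Re v < 2 leaves room for some q < 2,
    and [Un_cv_0_of_ratio] applies with p = 2. *)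
Lemma nbinom_little_o (v : Cplx) :
  Re v < 2 -> Un_cv (fun n => Cnorm (nbinom v (S n)) / INR (S n)) 0.
Proof.
  intros Hv.
  set (x := fun n => Cnorm (nbinom v n) / INR (S n)).
  assert (HS : forall n, 0 < INR (S n)) by (intros; apply lt_0_INR; lia).
  assert (Hx : forall n, 0 <= x n).
  { intros n; apply Rmult_le_pos; [apply Cnorm_ge0|].
    apply Rlt_le, Rinv_0_lt_compat, HS. }
  assert (Hrec : forall n,
    Cnorm (nbinom v (S n)) = Cnorm (v + RtoC (INR n))%X * x n).
  { intros n; specialize (HS n).
    pose proof (f_equal Cnorm (nbinom_S v n)) as H.
    rewrite Cnorm_opp, !Cnorm_mul, Cnorm_RtoC, Rabs_pos_eq in H by lra.
    apply Rmult_eq_reg_l with (INR (S n)); [|lra].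
    rewrite H; unfold x; field; lra. }
  (* The midpoint of max(Re v, 0) and 2: positive, above Re v and below 2. *)
  set (q := (Rmax (Re v) 0 + 2) / 2).
  assert (Hq : 0 < q < 2 /\ Re v < q).
  { unfold q, Rmax; destruct (Rle_dec (Re v) 0); lra. }
  (* Squaring |v + n| <= n + q gives |v|^2 <= 2n(q - Re v) + q^2, which holds from this threshold
     on. *)
  destruct (INR_unbounded
    ((Re v * Re v + Im v * Im v) / (2 * (q - Re v)))) as [n0 Hn0].
  assert (H0 : Un_cv x 0).
  { apply (Un_cv_0_of_ratio x 2 q n0); [lra|exact Hx|].
    intros n Hn; pose proof (HS n); pose proof (HS (S n)); pose proof (pos_INR n).
    replace (x (S n) * (INR n + 2)) with (Cnorm (v + RtoC (INR n))%X * x n).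
    - rewrite (Rmult_comm (x n)); apply Rmult_le_compat_r; [apply Hx|].
      unfold Cnorm; rewrite <- (sqrt_Rsqr (INR n + q)) by lra.
      apply sqrt_le_1_alt; unfold Cnorm2, Rsqr; simpl.
      assert (H3 : INR n0 <= INR n) by now apply le_INR.
      assert (H4 : Re v * Re v + Im v * Im v <= INR n * (2 * (q - Re v))).
      { replace (Re v * Re v + Im v * Im v) with
          ((Re v * Re v + Im v * Im v) / (2 * (q - Re v)) * (2 * (q - Re v)))
          by (field; lra).
        apply Rmult_le_compat_r; lra. }
      nra.
    - rewrite <- Hrec; unfold x; rewrite !S_INR in *; field; lra. }
  (* The claim divides |c_(n+1)| by n + 1, while x_(n+1) divides it by n + 2; the ratio (n + 2) / (n
     + 1) is at most 2, hence eps / 2. *)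
  intros eps Heps.
  destruct (H0 (eps / 2)) as [N HN]; [lra|].
  exists N; intros n Hn; specialize (HN (S n) ltac:(lia)).
  unfold Rdist in *; rewrite Rminus_0_r in *.
  rewrite Rabs_pos_eq in HN by apply Hx.
  pose proof (HS n); pose proof (HS (S n)).
  replace (Cnorm (nbinom v (S n)) / INR (S n))
    with (x (S n) * (INR (S (S n)) / INR (S n))) by (unfold x; field; lra).
  assert (H2 : 0 < INR (S (S n)) / INR (S n) <= 2).
  { split; [apply Rdiv_lt_0_compat; lra|].
    apply Rmult_le_reg_r with (INR (S n)); [lra|].
    unfold Rdiv; rewrite Rmult_assoc, Rinv_l, (S_INR (S n)) by lra.
    pose proof (pos_INR n); rewrite (S_INR n); lra. }
  pose proof (Hx (S n)).
  rewrite Rabs_pos_eq; nra.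
Qed.

(** * Passing to the limit under the integral *)

(** F is the integral up to T, S N the integrated partial sum, A N T its boundary term at T, and e N
    an error uniform in T. Letting T grow for two indices gives |S n - S m| <= e n + e m, so S is
    Cauchy; fixing one large N then carries its limit over to F. Series and integral thus converge
    together, with no limit known beforehand. *)
Lemma joint_limit (F : R -> R) (A : nat -> R -> R) (S e : nat -> R) :
  (forall N T, 0 <= T -> Rabs (F T - (A N T + S N)) <= e N) ->
  (forall N eps, 0 < eps -> exists M, forall T, M <= T -> Rabs (A N T) < eps) ->
  Un_cv e 0 ->
  exists L, Un_cv S L /\
    forall eps, 0 < eps -> exists M, forall T, M <= T -> Rabs (F T - L) < eps.
Proof.
  intros HF HA He.
  assert (Hdiff : forall n m, Rabs (S n - S m) <= e n + e m).
  { intros n m; apply le_epsilon; intros eps Heps.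
    destruct (HA n (eps / 2)) as [M1 H1]; [lra|].
    destruct (HA m (eps / 2)) as [M2 H2]; [lra|].
    set (T := Rmax 0 (Rmax M1 M2)).
    assert (HT : 0 <= T /\ M1 <= T /\ M2 <= T).
    { unfold T; pose proof (Rmax_l 0 (Rmax M1 M2)); pose proof (Rmax_r 0 (Rmax M1 M2)).
      pose proof (Rmax_l M1 M2); pose proof (Rmax_r M1 M2); lra. }
    specialize (H1 T ltac:(lra)); specialize (H2 T ltac:(lra)).
    pose proof (HF n T ltac:(lra)) as H3; pose proof (HF m T ltac:(lra)) as H4.
    apply Rabs_def2 in H1; apply Rabs_def2 in H2.
    apply Rabs_le_between in H3; apply Rabs_le_between in H4.
    apply Rabs_le; lra. }
  assert (He0 : forall eps, 0 < eps -> exists N, forall n, (n >= N)%nat -> e n < eps).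
  { intros eps Heps; destruct (He eps Heps) as [N HN]; exists N; intros n Hn.
    specialize (HN n Hn); unfold Rdist in HN.
    apply Rabs_def2 in HN; lra. }
  destruct (R_complete S) as [L HL].
  { intros eps Heps; destruct (He0 (eps / 2)) as [N HN]; [lra|].
    exists N; intros n m Hn Hm; unfold Rdist.
    pose proof (Hdiff n m); pose proof (HN n Hn); pose proof (HN m Hm); lra. }
  exists L; split; [exact HL|]; intros eps Heps.
  destruct (He0 (eps / 3)) as [N1 HN1]; [lra|].
  destruct (HL (eps / 3)) as [N2 HN2]; [lra|].
  set (N := Nat.max N1 N2).
  specialize (HN1 N ltac:(lia)); specialize (HN2 N ltac:(lia)).
  destruct (HA N (eps / 3)) as [M HM]; [lra|].
  exists (Rmax 0 M); intros T HT.
  pose proof (Rmax_l 0 M); pose proof (Rmax_r 0 M).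
  specialize (HM T ltac:(lra)); pose proof (HF N T ltac:(lra)) as H3.
  unfold Rdist in HN2.
  apply Rabs_def2 in HM; apply Rabs_def2 in HN2.
  apply Rabs_le_between in H3.
  apply Rabs_def1; lra.
Qed.

(** Integrating the pointwise bound gives (M/k)(1 - e^(-kT)), which is at most M/k whatever T is;
    [joint_limit] relies on this uniformity. *)
Lemma RInt_sub_primitive_le (f g A : R -> R) (M k T : R) :
  0 < k -> 0 <= M -> 0 <= T ->
  (forall x, 0 <= x -> continuous f x) ->
  (forall x, 0 <= x -> continuous g x) ->
  (forall x, 0 <= x -> is_derive A x (g x)) ->
  (forall x, 0 <= x -> Rabs (f x - g x) <= M * exp (- (k * x))) ->
  Rabs (RInt f 0 T - (A T - A 0)) <= M / k.
Proof.
  intros Hk HM HT Hf Hg HA Hle.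
  assert (I1 : is_RInt f 0 T (RInt f 0 T)).
  { apply (RInt_correct (V := R_CompleteNormedModule)), ex_RInt_continuous.
    rewrite Rmin_left, Rmax_right by lra; intros; apply Hf; lra. }
  assert (I2 : is_RInt g 0 T (A T - A 0)).
  { apply (is_RInt_derive A g); rewrite Rmin_left, Rmax_right by lra; intros;
      [apply HA|apply Hg]; lra. }
  assert (I3 : is_RInt (fun x => M * exp (- (k * x))) 0 T
    ((- (M / k)) * exp (- (k * T)) - (- (M / k)) * exp (- (k * 0)))).
  { apply (is_RInt_derive (fun x => (- (M / k)) * exp (- (k * x)))
      (fun x => M * exp (- (k * x)))); intros x _.
    - auto_derive; [trivial|]; field; lra.
    - apply (ex_derive_continuous (fun x => M * exp (- (k * x)))).
      auto_derive; trivial. }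
  pose proof (is_RInt_minus _ _ _ _ _ _ I1 I2) as I4.
  eapply Rle_trans.
  - eapply (norm_RInt_le _ _ 0 T _ _ HT) with (2 := I4) (3 := I3).
    intros x Hx; apply Hle; lra.
  - rewrite Rmult_0_r, Ropp_0, exp_0.
    assert (0 <= M / k) by (apply Rmult_le_pos; [lra|]; apply Rlt_le, Rinv_0_lt_compat; lra).
    pose proof (exp_pos (- (k * T))); nra.
Qed.

(** * Decaying exponentials *)

Definition edecay (m : Cplx) (x : R) : Cplx := Cexp (- (m * RtoC x))%X.

Lemma Cnorm_edecay (m : Cplx) (x : R) : Cnorm (edecay m x) = exp (- (Re m * x)).
Proof. unfold edecay; rewrite Cnorm_exp; simpl; f_equal; ring. Qed.

Lemma edecay_add (m m' : Cplx) (x : R) :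
  edecay (m + m')%X x = (edecay m x * edecay m' x)%X.
Proof. unfold edecay; rewrite <- Cexp_add; f_equal; ring. Qed.

Lemma Cderiv_edecay (m : Cplx) (x : R) : Cderiv (edecay m) x (- m * edecay m x)%X.
Proof.
  assert (H : Cderiv (fun t => - (m * RtoC t))%X x (- m)%X).
  { pose proof (Cderiv_scal RtoC x (- m)%X Cone (Cderiv_RtoC x)) as [H1 H2].
    replace (- m * Cone)%X with (- m)%X in * by ring.
    split; [eapply is_derive_ext; [|exact H1]|eapply is_derive_ext; [|exact H2]];
      intros t; simpl; ring. }
  exact (Cderiv_exp _ _ _ H).
Qed.

Lemma edecay_vanishes (m : Cplx) (eps : R) :
  0 < Re m -> 0 < eps -> exists M, forall T, M <= T -> Cnorm (edecay m T) < eps.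
Proof.
  (* Beyond this point Re m T >= 1 - ln eps, so the modulus is at most eps / e. *)
  intros Hm He; exists ((1 - ln eps) / Re m); intros T HT.
  rewrite Cnorm_edecay, <- (exp_ln eps He); apply exp_increasing.
  apply (Rmult_le_compat_l (Re m)) in HT; [|lra].
  replace (Re m * ((1 - ln eps) / Re m)) with (1 - ln eps) in HT by (field; lra).
  lra.
Qed.

(* Near [x = 0] the point [e^(-2cx)] lies in the right half-plane, and further
   out its modulus is bounded away from 1. *)
Lemma one_plus_edecay_lower (c : Cplx) :
  0 < Re c -> exists d, 0 < d <= 1 /\
    forall x, 0 <= x -> d <= Re (Cone + edecay (RtoC 2 * c) x)%X.
Proof.
  intros Hc.
  set (b := Rabs (Im c)); assert (Hb : 0 <= b) by apply Rabs_pos.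
  (* Up to [x0] the phase 2 Im(c) x stays within 1 < pi/2 of zero, so its cosine is nonnegative;
     beyond it the modulus is at most [e0], whence the bound [1 - e0]. *)
  set (x0 := / (2 * b + 1)).
  assert (Hx0 : 0 < x0) by (apply Rinv_0_lt_compat; lra).
  set (e0 := exp (- (2 * Re c * x0))).
  assert (He0 : 0 < e0 < 1).
  { split; [apply exp_pos|]; rewrite <- exp_0; apply exp_increasing; nra. }
  exists (1 - e0); split; [lra|]; intros x Hx.
  set (th := 2 * Im c * x).
  replace (Re _) with (1 + exp (- (2 * Re c * x)) * cos th).
  2: { unfold th; rewrite <- (cos_neg (2 * Im c * x)); simpl.
       f_equal; f_equal; f_equal; ring. }
  assert (Hth : Rabs th = 2 * b * x).
  { unfold th, b.
    rewrite !Rabs_mult, (Rabs_pos_eq x), (Rabs_pos_eq 2) by lra; ring. }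
  pose proof (exp_pos (- (2 * Re c * x))) as Hexp.
  destruct (Rle_or_lt x x0) as [Hle|Hlt].
  - assert (Habs : Rabs th <= 1).
    { rewrite Hth; apply Rle_trans with (2 * b * x0).
      - apply Rmult_le_compat_l; lra.
      - unfold x0; apply Rmult_le_reg_r with (2 * b + 1); [lra|].
        rewrite Rmult_assoc, Rinv_l; lra. }
    apply Rabs_le_between in Habs; pose proof PI2_1.
    assert (0 <= cos th) by (apply cos_ge_0; lra).
    nra.
  - assert (exp (- (2 * Re c * x)) <= e0).
    { left; apply exp_increasing; nra. }
    pose proof (COS_bound th); nra.
Qed.

Lemma edecay_pown (m : Cplx) (n : nat) (x : R) :
  Cpown (edecay m x) n = edecay (m * RtoC (INR n))%X x.
Proof.
  induction n as [|n IH].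
  - cbn [Cpown INR]; unfold edecay; rewrite <- Cexp_zero; f_equal.
    replace (RtoC 0) with Czero by reflexivity; ring.
  - cbn [Cpown]; rewrite IH, <- edecay_add, S_INR, RtoC_plus; f_equal.
    replace (RtoC 1) with Cone by reflexivity; ring.
Qed.

Definition vanishes (g : R -> Cplx) : Prop :=
  forall eps, 0 < eps -> exists M, forall T, M <= T -> Cnorm (g T) < eps.

Lemma vanishes_zero : vanishes (fun _ => Czero).
Proof.
  intros eps He; exists 0; intros T _; unfold Czero; rewrite Cnorm_RtoC, Rabs_R0; lra.
Qed.

Lemma vanishes_add (g h : R -> Cplx) :
  vanishes g -> vanishes h -> vanishes (fun T => g T + h T)%X.
Proof.
  intros Hg Hh eps He.
  destruct (Hg (eps / 2)) as [M1 H1]; [lra|].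
  destruct (Hh (eps / 2)) as [M2 H2]; [lra|].
  exists (Rmax M1 M2); intros T HT.
  pose proof (Rmax_l M1 M2); pose proof (Rmax_r M1 M2).
  specialize (H1 T ltac:(lra)); specialize (H2 T ltac:(lra)).
  pose proof (Cnorm_triangle (g T) (h T)); lra.
Qed.

Lemma vanishes_scal (z : Cplx) (g : R -> Cplx) :
  vanishes g -> vanishes (fun T => z * g T)%X.
Proof.
  intros Hg eps He; pose proof (Cnorm_ge0 z) as Hz.
  destruct (Hg (eps / (Cnorm z + 1))) as [M HM].
  { apply Rdiv_lt_0_compat; lra. }
  exists M; intros T HT; specialize (HM T HT); rewrite Cnorm_mul.
  pose proof (Cnorm_ge0 (g T)).
  apply Rle_lt_trans with ((Cnorm z + 1) * Cnorm (g T)); [nra|].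
  replace eps with ((Cnorm z + 1) * (eps / (Cnorm z + 1))) by (field; lra).
  apply Rmult_lt_compat_l; lra.
Qed.

Lemma vanishes_sum (u : nat -> R -> Cplx) (N : nat) :
  (forall n, vanishes (u n)) -> vanishes (fun T => Csum (fun n => u n T) N).
Proof.
  intros H; induction N as [|N IH]; simpl; [apply H|].
  now apply (vanishes_add (fun T => Csum (fun n => u n T) N)).
Qed.

(** * Sums over a list of exponents, later the four values vc +- a +- b *)

Definition Clsum (g : Cplx -> Cplx) (l : list Cplx) : Cplx :=
  fold_right (fun m acc => g m + acc)%X Czero l.

Lemma Clsum_ext (g h : Cplx -> Cplx) (l : list Cplx) :
  (forall m, In m l -> g m = h m) -> Clsum g l = Clsum h l.
Proof.
  induction l as [|m l IH]; intros H; [reflexivity|].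
  simpl; rewrite H, IH; [reflexivity| |now left].
  intros; apply H; now right.
Qed.

Lemma Clsum_scal (z : Cplx) (g : Cplx -> Cplx) (l : list Cplx) :
  Clsum (fun m => z * g m)%X l = (z * Clsum g l)%X.
Proof. induction l as [|m l IH]; simpl; [ring|]; rewrite IH; ring. Qed.

Lemma Cnorm_Clsum_le1 (g : Cplx -> Cplx) (l : list Cplx) :
  (forall m, In m l -> Cnorm (g m) <= 1) -> Cnorm (Clsum g l) <= INR (length l).
Proof.
  induction l as [|m l IH]; intros H.
  - simpl; unfold Czero; rewrite Cnorm_RtoC, Rabs_R0; lra.
  - cbn [length]; rewrite S_INR; simpl Clsum.
    eapply Rle_trans; [apply Cnorm_triangle|].
    assert (Cnorm (g m) <= 1) by (apply H; now left).
    assert (Cnorm (Clsum g l) <= INR (length l)) by (apply IH; intros; apply H; now right).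
    lra.
Qed.

Lemma Cderiv_Clsum (g : Cplx -> R -> Cplx) (d : Cplx -> Cplx) (x : R) (l : list Cplx) :
  (forall m, Cderiv (g m) x (d m)) ->
  Cderiv (fun t => Clsum (fun m => g m t) l) x (Clsum d l).
Proof.
  intros H; induction l as [|m l IH]; simpl; [apply Cderiv_const|].
  now apply (Cderiv_add (g m)).
Qed.

Lemma vanishes_Clsum (g : Cplx -> R -> Cplx) (l : list Cplx) :
  (forall m, In m l -> vanishes (g m)) -> vanishes (fun T => Clsum (fun m => g m T) l).
Proof.
  induction l as [|m l IH]; intros H; simpl; [exact vanishes_zero|].
  apply (vanishes_add (g m)); [apply H; now left|].
  apply IH; intros; apply H; now right.
Qed.

(** * Term-by-term integration *)

Lemma Un_cv_scal (e : nat -> R) (C : R) : Un_cv e 0 -> Un_cv (fun n => C * e n) 0.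
Proof.
  intros H; replace 0 with (C * 0) by ring.
  apply (CV_mult (fun _ => C) e); [|exact H].
  intros eps He; exists 0%nat; intros; unfold Rdist.
  replace (C - C) with 0 by ring; now rewrite Rabs_R0.
Qed.

(** Passes from the total function [RInt] to [RiemannInt], which carries an integrability proof. *)
Lemma improper_int_R_of_RInt (g : R -> R) (L : R) :
  (forall x, 0 <= x -> continuous g x) ->
  (forall eps, 0 < eps -> exists M, forall T, M <= T -> Rabs (RInt g 0 T - L) < eps) ->
  improper_int_R g L.
Proof.
  intros Hc HL; split.
  - intros T HT; constructor; apply ex_RInt_Reals_0.
    apply (ex_RInt_continuous (V := R_CompleteNormedModule)).
    rewrite Rmin_left, Rmax_right by lra; intros; apply Hc; lra.
  - intros eps He; destruct (HL eps He) as [M HM].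
    exists M; intros T HT pr; rewrite <- RInt_Reals; now apply HM.
Qed.

(** With [k = 1] this is the integrand with its binomial series cut at N; with [k = - / mu] it is a
    primitive of that. A free coefficient lets one derivative rule serve both. *)
Definition exp_poly (k : nat -> Cplx -> Cplx) (v c z : Cplx) (ms : list Cplx)
    (N : nat) (x : R) : Cplx :=
  (z * Csum (fun n => nbinom v n * Clsum (fun m =>
     k n m * edecay (m + RtoC 2 * c * RtoC (INR n)) x) ms) N)%X.

Lemma Cderiv_exp_poly (k : nat -> Cplx -> Cplx) (v c z : Cplx) (ms : list Cplx)
    (N : nat) (x : R) :
  Cderiv (exp_poly k v c z ms N) x
    (exp_poly (fun n m => k n m * - (m + RtoC 2 * c * RtoC (INR n)))%X v c z ms N x).
Proof.
  unfold exp_poly; apply Cderiv_scal.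
  apply (Cderiv_sum (fun n x => nbinom v n * Clsum (fun m =>
     k n m * edecay (m + RtoC 2 * c * RtoC (INR n)) x) ms)%X); intros n.
  apply Cderiv_scal.
  apply (Cderiv_Clsum (fun m x => k n m * edecay (m + RtoC 2 * c * RtoC (INR n)) x)%X);
    intros m.
  replace (k n m * - (m + RtoC 2 * c * RtoC (INR n))
      * edecay (m + RtoC 2 * c * RtoC (INR n)) x)%X
    with (k n m * (- (m + RtoC 2 * c * RtoC (INR n))
      * edecay (m + RtoC 2 * c * RtoC (INR n)) x))%X by ring.
  apply Cderiv_scal, Cderiv_edecay.
Qed.

(** [joint_limit] is applied to real and imaginary parts. The constant [L] is only asserted to
    exist: its role is to be the common value of the series and of the integral. *)
Lemma improper_int_binomial (v c z : Cplx) (ms : list Cplx) (f : R -> Cplx) :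
  Re v < 2 -> 0 < Re c -> (forall m, In m ms -> 0 < Re m) ->
  (forall x, f x = z * (Cpow (Cone + edecay (RtoC 2 * c) x) (- v)
                     * Clsum (fun m => edecay m x) ms))%X ->
  let S := fun N => (z * Csum (fun n => nbinom v n *
        Clsum (fun m => / (m + RtoC 2 * c * RtoC (INR n))) ms) N)%X in
  exists L : Cplx,
    (Un_cv (fun N => Re (S N)) (Re L) /\ Un_cv (fun N => Im (S N)) (Im L)) /\
    improper_int_C f L.
Proof.
  intros Hv Hc Hms Hf S.
  set (w := edecay (RtoC 2 * c)%X).
  set (mu := fun n m => (m + RtoC 2 * c * RtoC (INR n))%X).
  set (A := exp_poly (fun n m => - / mu n m)%X v c z ms).
  set (g := exp_poly (fun _ _ => Cone) v c z ms).
  assert (Hmu : forall n m, In m ms -> 0 < Re (mu n m)).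
  { intros n m Hm; specialize (Hms m Hm); unfold mu; simpl.
    pose proof (pos_INR n); nra. }
  destruct (one_plus_edecay_lower c Hc) as [d [Hd Hlow]].
  destruct (binomial_remainder v d Hd) as [K [HK Hrem]].
  (* Differentiability is established for the sake of continuity, hence integrability on each
     [0, T]. *)
  assert (Hfd : forall x, 0 <= x -> exists l, Cderiv f x l).
  { intros x Hx.
    assert (H1 : Cderiv (fun t => Cone + w t)%X x
      (Czero + - (RtoC 2 * c) * edecay (RtoC 2 * c) x)%X).
    { apply (Cderiv_add (fun _ => Cone)); [apply Cderiv_const|apply Cderiv_edecay]. }
    assert (H0 : 0 < Re (Cone + w x)%X) by (specialize (Hlow x Hx); unfold w; lra).
    pose proof (Cderiv_log _ _ _ H0 H1) as H2.
    pose proof (Cderiv_exp _ _ _ (Cderiv_scal _ _ (- v)%X _ H2)) as H3.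
    pose proof (Cderiv_Clsum edecay _ x ms (fun m => Cderiv_edecay m x)) as H4.
    pose proof (Cderiv_scal _ _ z _ (Cderiv_mul _ _ _ _ _ H3 H4)) as [H5 H6].
    eexists; split; (eapply is_derive_ext; [|eassumption]); intros t;
      rewrite Hf; reflexivity. }
  assert (HA : forall N x, Cderiv (A N) x (g N x)).
  { intros N x; unfold A, g.
    replace (exp_poly (fun _ _ => Cone) v c z ms N x) with
      (exp_poly (fun n m => - / mu n m * - mu n m)%X v c z ms N x).
    - apply Cderiv_exp_poly.
    - unfold exp_poly; f_equal; apply Csum_ext; intros n; f_equal.
      apply Clsum_ext; intros m Hm; f_equal; field.
      apply Re_pos_neq0, Hmu, Hm. }
  assert (Hgd : forall N x, exists l, Cderiv (g N) x l)
    by (intros; eexists; apply Cderiv_exp_poly).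
  set (C := Cnorm z * K * INR (length ms)).
  set (kk := fun N => 2 * Re c * INR (Datatypes.S N)).
  assert (Hkk : forall N, 0 < kk N).
  { intros N; unfold kk; assert (0 < INR (Datatypes.S N)) by (apply lt_0_INR; lia).
    apply Rmult_lt_0_compat; lra. }
  assert (HC : 0 <= C).
  { unfold C; repeat apply Rmult_le_pos; auto using Cnorm_ge0, pos_INR. }
  assert (Hdiff : forall N x, 0 <= x ->
    Cnorm (f x - g N x)%X
      <= C * Cnorm (nbinom v (Datatypes.S N)) * exp (- (kk N * x))).
  { intros N x Hx.
    replace (g N x) with (z * (Clsum (fun m => edecay m x) ms
      * Csum (fun n => nbinom v n * Cpown (w x) n) N))%X.
    2: { unfold g, exp_poly; f_equal; rewrite <- Csum_scal; apply Csum_ext; intros n.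
      transitivity (nbinom v n * (Cpown (w x) n * Clsum (fun m => edecay m x) ms))%X;
        [ring|].
      rewrite <- Clsum_scal; f_equal; apply Clsum_ext; intros m _.
      unfold w; rewrite edecay_pown, edecay_add; ring. }
    rewrite Hf; fold (w x).
    set (E := Clsum (fun m => edecay m x) ms); set (P := Csum _ N).
    replace (_ - _)%X with (z * ((Cpow (Cone + w x) (- v) - P) * E))%X by ring.
    rewrite !Cnorm_mul.
    assert (Hle1 : forall m, 0 < Re m -> Cnorm (edecay m x) <= 1).
    { intros m Hm; rewrite Cnorm_edecay, <- exp_0.
      destruct (Req_dec x 0) as [-> | Hx0]; [right; f_equal; ring|].
      left; apply exp_increasing; nra. }
    assert (H2c : 0 < Re (RtoC 2 * c)%X) by (simpl; lra).
    assert (HE : Cnorm E <= INR (length ms)).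
    { apply Cnorm_Clsum_le1; intros m Hm; apply Hle1, Hms, Hm. }
    pose proof (Hrem (w x) N (Hle1 _ H2c) (Hlow x Hx)) as HR; fold P in HR.
    (* Turns |w|^(N+1) into e^(-2 Re(c) (N+1) x). *)
    rewrite <- Cnorm_pown in HR; unfold w in HR at 2.
    rewrite edecay_pown, Cnorm_edecay in HR.
    replace (Re (RtoC 2 * c * RtoC (INR (Datatypes.S N)))%X) with (kk N) in HR
      by (unfold kk; cbn [Re Im Cmul RtoC]; ring).
    replace (C * _ * _) with (Cnorm z * ((K * Cnorm (nbinom v (Datatypes.S N))
      * exp (- (kk N * x))) * INR (length ms))) by (unfold C; ring).
    apply Rmult_le_compat_l; [apply Cnorm_ge0|].
    apply Rmult_le_compat; auto using Cnorm_ge0. }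
  (* This is M/k of [RInt_sub_primitive_le] for the bound [Hdiff]. *)
  set (e := fun N => C / (2 * Re c)
    * (Cnorm (nbinom v (Datatypes.S N)) / INR (Datatypes.S N))).
  assert (He : Un_cv e 0) by (apply Un_cv_scal, nbinom_little_o, Hv).
  (* All exponentials equal 1 at x = 0, so the lower boundary term of the primitive produces the
     series. *)
  assert (HA0 : forall N, A N 0 = (- S N)%X).
  { intros N; unfold A, S, exp_poly.
    transitivity (z * (- Cone * Csum (fun n => nbinom v n
      * Clsum (fun m => / mu n m) ms) N))%X; [|unfold mu; ring].
    f_equal; rewrite <- Csum_scal; apply Csum_ext; intros n.
    transitivity (nbinom v n * (- Cone * Clsum (fun m => / mu n m) ms))%X; [|ring].
    f_equal; rewrite <- Clsum_scal; apply Clsum_ext; intros m _.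
    replace (edecay _ 0) with Cone; [ring|].
    unfold edecay; rewrite <- Cexp_zero; f_equal.
    replace (RtoC 0) with Czero by reflexivity; ring. }
  assert (HAv : forall N, vanishes (A N)).
  { intros N; unfold A, exp_poly; apply vanishes_scal.
    apply (vanishes_sum (fun n x => nbinom v n * Clsum (fun m =>
      - / mu n m * edecay (m + RtoC 2 * c * RtoC (INR n)) x) ms)%X); intros n.
    apply vanishes_scal.
    apply (vanishes_Clsum (fun m x => - / mu n m
      * edecay (m + RtoC 2 * c * RtoC (INR n)) x)%X); intros m Hm.
    apply vanishes_scal; intros eps Heps; apply edecay_vanishes; [|exact Heps].
    apply (Hmu n m Hm). }
  assert (Hmain : forall p : Cplx -> R,
    (p = Re \/ p = Im) ->
    exists L, Un_cv (fun N => p (S N)) L /\ improper_int_R (fun x => p (f x)) L).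
  { intros p Hp.
    assert (Hple : forall y, Rabs (p y) <= Cnorm y)
      by (destruct Hp as [-> | ->]; [exact Re_le_Cnorm|exact Im_le_Cnorm]).
    assert (Hpsub : forall y y', p (y - y')%X = p y - p y')
      by (destruct Hp as [-> | ->]; intros; simpl; ring).
    assert (Hpopp : forall y, p (- y)%X = - p y)
      by (destruct Hp as [-> | ->]; reflexivity).
    assert (Hpd : forall h x l, Cderiv h x l -> is_derive (fun t => p (h t)) x (p l))
      by (destruct Hp as [-> | ->]; intros h x l [H1 H2]; assumption).
    assert (Hpc : forall h x, (exists l, Cderiv h x l) ->
      continuous (fun t => p (h t)) x).
    { intros h x [l Hl]; apply (ex_derive_continuous (fun t => p (h t))).
      eexists; apply Hpd, Hl. }
    destruct (joint_limit (fun T => RInt (fun x => p (f x)) 0 T)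
      (fun N T => p (A N T)) (fun N => p (S N)) e) as [L [HL1 HL2]]; [ | |exact He|].
    - intros N T HT.
      replace (p (A N T) + p (S N)) with (p (A N T) - p (A N 0))
        by (rewrite HA0, Hpopp; ring).
      replace (e N) with (C * Cnorm (nbinom v (Datatypes.S N)) / kk N).
      2: { unfold e, kk; field; split; [|lra]; apply not_0_INR; lia. }
      apply (RInt_sub_primitive_le (fun x => p (f x)) (fun x => p (g N x))
        (fun x => p (A N x))); auto.
      + apply Rmult_le_pos; [exact HC|apply Cnorm_ge0].
      + intros x Hx; rewrite <- Hpsub.
        eapply Rle_trans; [apply Hple|now apply Hdiff].
    - intros N eps Heps; destruct (HAv N eps Heps) as [M HM].
      exists M; intros T HT; eapply Rle_lt_trans; [apply Hple|now apply HM].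
    - exists L; split; [exact HL1|].
      apply improper_int_R_of_RInt; auto. }
  destruct (Hmain Re (or_introl eq_refl)) as [L1 [HS1 HI1]].
  destruct (Hmain Im (or_intror eq_refl)) as [L2 [HS2 HI2]].
  exists (mkC L1 L2); split; split; assumption.
Qed.

(** * Pochhammer quotients and partial fractions *)

(** Both sides are (z)_(n+1). *)
Lemma poch_shift (z : Cplx) (n : nat) :
  (z * poch (Cone + z) n)%X = (poch z n * (z + RtoC (INR n)))%X.
Proof.
  induction n as [|n IH].
  - simpl; replace (RtoC 0) with Czero by reflexivity; ring.
  - cbn [poch]; rewrite S_INR, RtoC_plus.
    replace (RtoC 1) with Cone by reflexivity.
    transitivity ((z * poch (Cone + z) n) * (Cone + z + RtoC (INR n)))%X; [ring|].
    rewrite IH; ring.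
Qed.

Lemma poch_neq0 (z : Cplx) (n : nat) : not_nonpos_int z -> poch z n <> Czero.
Proof.
  intros Hz; induction n as [|n IH]; cbn [poch].
  - apply RtoC_neq0; lra.
  - apply Cmul_neq0; [exact IH|]; intros H; apply (Hz n).
    replace z with ((z + RtoC (INR n)) - RtoC (INR n))%X by ring.
    rewrite H; apply Cplx_ext; simpl; ring.
Qed.

Lemma poch_succ_arg (z : Cplx) (n : nat) :
  z <> Czero -> poch (Cone + z)%X n = (poch z n * ((z + RtoC (INR n)) / z))%X.
Proof.
  intros Hz; transitivity (z * poch (Cone + z) n / z)%X; [field; exact Hz|].
  rewrite poch_shift; field; exact Hz.
Qed.

(** Used for the sigma_j, where the denominator symbol (1 + sigma_j)_n is the one known to be
    nonzero, so everything is expressed through it. *)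
Lemma poch_pred_arg (z : Cplx) (n : nat) :
  (z + RtoC (INR n))%X <> Czero ->
  poch z n = (poch (Cone + z) n * (z / (z + RtoC (INR n))))%X.
Proof.
  intros Hz; transitivity (z * poch (Cone + z) n / (z + RtoC (INR n)))%X.
  - rewrite poch_shift; field; exact Hz.
  - field; exact Hz.
Qed.

Lemma not_nonpos_int_neq0 (z : Cplx) : not_nonpos_int z -> z <> Czero.
Proof.
  intros H Hz; apply (H 0%nat); rewrite Hz; apply Cplx_ext; simpl; ring.
Qed.

(** In the scaled variables V = v/2, A = a/(2c), B = b/(2c), each vc +- a +- b is 2c times a
    sigma_j, so P = 16 c^4 s3 s4 s5 s6 and the cubic numerator is 8 c^3 V D. In the application D =
    lambda_1 lambda_2 and D' = (lambda_1 + n)(lambda_2 + n). *)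
Lemma partial_fractions (V A B c n : Cplx) :
  let t := (Cone + Cone)%X in
  let v := (t * V)%X in let a := (t * c * A)%X in let b := (t * c * B)%X in
  let vc := (v * c)%X in
  let P := ((vc - a - b) * (vc + a + b) * (vc - a + b) * (vc + a - b))%X in
  let s3 := (V - A - B)%X in let s4 := (V - A + B)%X in
  let s5 := (V + A + B)%X in let s6 := (V + A - B)%X in
  let D := (V * V - (A * A + B * B))%X in
  let D' := ((V + n) * (V + n) - (A * A + B * B))%X in
  t <> Czero -> c <> Czero -> V <> Czero -> D <> Czero ->
  s3 <> Czero -> s4 <> Czero -> s5 <> Czero -> s6 <> Czero ->
  (s3 + n)%X <> Czero -> (s4 + n)%X <> Czero ->
  (s5 + n)%X <> Czero -> (s6 + n)%X <> Czero ->
  ((vc * vc * vc - a * a * vc - b * b * vc) / P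
    * ((V + n) / V * (D' / D)
    * (s3 / (s3 + n) * (s4 / (s4 + n)) * (s5 / (s5 + n)) * (s6 / (s6 + n)))))%X
  = ((/ (vc + a + b + t * c * n) + / (vc + a - b + t * c * n)
    + / (vc - a + b + t * c * n) + / (vc - a - b + t * c * n)) / (t * t))%X.
Proof.
  intros t v a b vc P s3 s4 s5 s6 D D' Ht Hc HV HD H3 H4 H5 H6 K3 K4 K5 K6.
  replace (vc * vc * vc - a * a * vc - b * b * vc)%X
    with (t * t * t * c * c * c * V * D)%X by (unfold vc, v, a, b, D; ring).
  replace P with (t * t * t * t * c * c * c * c * s3 * s4 * s5 * s6)%X
    by (unfold P, vc, v, a, b, s3, s4, s5, s6; ring).
  replace (vc + a + b + t * c * n)%X with (t * c * (s5 + n))%X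
    by (unfold vc, v, a, b, s5; ring).
  replace (vc + a - b + t * c * n)%X with (t * c * (s6 + n))%X
    by (unfold vc, v, a, b, s6; ring).
  replace (vc - a + b + t * c * n)%X with (t * c * (s4 + n))%X
    by (unfold vc, v, a, b, s4; ring).
  replace (vc - a - b + t * c * n)%X with (t * c * (s3 + n))%X
    by (unfold vc, v, a, b, s3; ring).
  (* With y = V + n, pairing opposite signs gives 2y/(y^2 - (A+B)^2) + 2y/(y^2 - (A-B)^2), whose
     numerator is 4y(y^2 - A^2 - B^2). Here the value t = 2 enters; afterwards [t] is a nonzero
     atom. *)
  assert (HX : (/ (s3 + n) + / (s4 + n) + / (s5 + n) + / (s6 + n))%X
    = (t * t * (V + n) * D' / ((s3 + n) * (s4 + n) * (s5 + n) * (s6 + n)))%X).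
  { unfold t, D', s3, s4, s5, s6 in *; field; repeat split; assumption. }
  transitivity ((/ (s3 + n) + / (s4 + n) + / (s5 + n) + / (s6 + n)) / (t * t * t * c))%X.
  - rewrite HX; clearbody D D' s3 s4 s5 s6 t; field; repeat split; assumption.
  - clearbody s3 s4 s5 s6 t; field; repeat split; assumption.
Qed.

(** Parameters that differ by 1 telescope: 1 + p over p leaves (p + n)/p, and s_j over 1 + s_j
    leaves s_j/(s_j + n). What remains, (v)_n (-1)^n / n!, is the binomial coefficient. *)
Lemma hyp_term_shifted (v p q r s3 s4 s5 s6 : Cplx) (n : nat) :
  let k := RtoC (INR n) in
  not_nonpos_int p -> not_nonpos_int q -> not_nonpos_int r ->
  not_nonpos_int (Cone + s3)%X -> not_nonpos_int (Cone + s4)%X ->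
  not_nonpos_int (Cone + s5)%X -> not_nonpos_int (Cone + s6)%X ->
  (s3 + k)%X <> Czero -> (s4 + k)%X <> Czero ->
  (s5 + k)%X <> Czero -> (s6 + k)%X <> Czero ->
  hyp_term [v; Cone + p; Cone + q; Cone + r; s3; s4; s5; s6]%X
    [p; q; r; Cone + s3; Cone + s4; Cone + s5; Cone + s6]%X (RtoC (-1)) n
  = (nbinom v n * ((p + k) / p * ((q + k) * (r + k) / (q * r))
      * (s3 / (s3 + k) * (s4 / (s4 + k)) * (s5 / (s5 + k)) * (s6 / (s6 + k)))))%X.
Proof.
  intros k Hp Hq Hr H3 H4 H5 H6 K3 K4 K5 K6.
  unfold hyp_term, nbinom, poch_prod; cbn [fold_right].
  rewrite (poch_succ_arg p), (poch_succ_arg q), (poch_succ_arg r)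
    by now apply not_nonpos_int_neq0.
  rewrite (poch_pred_arg s3), (poch_pred_arg s4), (poch_pred_arg s5),
    (poch_pred_arg s6) by assumption.
  fold k.
  pose proof (poch_neq0 _ n Hp); pose proof (poch_neq0 _ n Hq).
  pose proof (poch_neq0 _ n Hr); pose proof (poch_neq0 _ n H3).
  pose proof (poch_neq0 _ n H4); pose proof (poch_neq0 _ n H5).
  pose proof (poch_neq0 _ n H6).
  assert (HF : RtoC (INR (fact n)) <> Czero)
    by apply RtoC_neq0, INR_fact_neq_0.
  apply not_nonpos_int_neq0 in Hp, Hq, Hr.
  clear H3 H4 H5 H6.
  (* The factorial and the Pochhammer symbols in the denominators become nonzero atoms, leaving a
     rational identity for [field]. *)
  generalize dependent (RtoC (INR (fact n))); intros F HF.
  generalize dependent (poch p n); intros.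
  generalize dependent (poch q n); intros.
  generalize dependent (poch r n); intros.
  generalize dependent (poch (Cone + s3)%X n); intros.
  generalize dependent (poch (Cone + s4)%X n); intros.
  generalize dependent (poch (Cone + s5)%X n); intros.
  generalize dependent (poch (Cone + s6)%X n); intros.
  clearbody k; field; repeat split; assumption.
Qed.

(** * The integrand as a sum of exponentials, and the evaluation *)

(** The product of the two hyperbolic cosines is a quarter of the sum of e^((+-a+-b)x); the factor
    e^(-vcx) from the denominator turns these into the four decaying exponentials. *)
Lemma Cdiv_cosh_pow (v a b c : Cplx) (x : R) :
  Cdiv (Cmul (Ccosh (Cmul a (RtoC x))) (Ccosh (Cmul b (RtoC x)))) (cosh_pow v c x)
  = (two_pow v / ((Cone + Cone) * (Cone + Cone))
     * (Cpow (Cone + edecay (RtoC 2 * c) x) (- v)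
       * Clsum (fun m => edecay m x)
         [v * c + a + b; v * c + a - b; v * c - a + b; v * c - a - b]))%X.
Proof.
  unfold cosh_pow, Ccosh.
  replace (edecay (RtoC 2 * c) x) with (Cexp (- (RtoC 2 * (c * RtoC x))))%X
    by (unfold edecay; f_equal; ring).
  rewrite Cpow_opp; set (W := Cpow _ v); simpl Clsum.
  set (Ea := Cexp (a * RtoC x)%X); set (Eb := Cexp (b * RtoC x)%X).
  set (Ev := Cexp (v * (c * RtoC x))%X).
  (* One formula covers all four exponents, with [p] and [q] taken as a or -a and b or -b. *)
  assert (HE : forall p q, edecay (v * c + p + q)%X x
    = (/ Ev * Cexp (- (p * RtoC x)) * Cexp (- (q * RtoC x)))%X).
  { intros p q; unfold Ev, edecay; rewrite <- Cexp_opp, <- !Cexp_add; f_equal; ring. }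
  assert (HN : forall p, Cexp (- (- p * RtoC x))%X = Cexp (p * RtoC x)%X)
    by (intros p; f_equal; ring).
  unfold Csub; rewrite !HE, !HN, !Cexp_opp; fold Ea Eb; fold (two_pow v).
  rewrite RtoC_2.
  assert (Ht : (Cone + Cone)%X <> Czero) by (rewrite <- RtoC_2; apply RtoC_neq0; lra).
  assert (HW : W <> Czero) by apply Cexp_neq0.
  assert (Ha : Ea <> Czero) by apply Cexp_neq0.
  assert (Hb : Eb <> Czero) by apply Cexp_neq0.
  assert (Hv : Ev <> Czero) by apply Cexp_neq0.
  assert (H2 : two_pow v <> Czero) by apply Cexp_neq0.
  clearbody W Ea Eb Ev; set (tp := two_pow v) in *; clearbody tp.
  set (t := (Cone + Cone)%X) in *; clearbody t.
  field; repeat split; assumption.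
Qed.

Lemma hyp_partial_Csum (al be : list Cplx) (z : Cplx) (N : nat) :
  hyp_partial al be z N = Csum (hyp_term al be z) N.
Proof. induction N as [|N IH]; simpl; rewrite ?IH; reflexivity. Qed.

Theorem mainTheorem17 (v a b c s : Cplx)
  (hv : Re v < 2) (hc : 0 < Re c)
  (h1 : 0 < Re (Cadd (Cadd (Cmul v c) a) b))
  (h2 : 0 < Re (Csub (Cadd (Cmul v c) a) b))
  (h3 : 0 < Re (Cadd (Csub (Cmul v c) a) b))
  (h4 : 0 < Re (Csub (Csub (Cmul v c) a) b))
  (hs : Cmul s s = Cadd (Cmul a a) (Cmul b b)) :
  let v2 := Cdiv v (RtoC 2) in
  let c2 := Cmul (RtoC 2) c in
  let l1 := Csub v2 (Cdiv s c2) in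
  let l2 := Cadd v2 (Cdiv s c2) in
  let s3 := Csub (Csub v2 (Cdiv a c2)) (Cdiv b c2) in
  let s4 := Cadd (Csub v2 (Cdiv a c2)) (Cdiv b c2) in
  let s5 := Cadd (Cadd v2 (Cdiv a c2)) (Cdiv b c2) in
  let s6 := Csub (Cadd v2 (Cdiv a c2)) (Cdiv b c2) in
  let vc := Cmul v c in
  let P := Cmul (Cmul (Cmul (Csub (Csub vc a) b) (Cadd (Cadd vc a) b))
                      (Cadd (Csub vc a) b)) (Csub (Cadd vc a) b) in
  not_nonpos_int v2 -> not_nonpos_int l1 -> not_nonpos_int l2 ->
  not_nonpos_int (Cadd Cone s3) -> not_nonpos_int (Cadd Cone s4) ->
  not_nonpos_int (Cadd Cone s5) -> not_nonpos_int (Cadd Cone s6) ->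
  exists S : Cplx,
    hyp_series_sum [v; Cadd Cone v2; Cadd Cone l1; Cadd Cone l2; s3; s4; s5; s6]
                   [v2; l1; l2; Cadd Cone s3; Cadd Cone s4; Cadd Cone s5; Cadd Cone s6]
                   (RtoC (-1)) S /\
    improper_int_C
      (fun x => Cdiv (Cmul (Ccosh (Cmul a (RtoC x))) (Ccosh (Cmul b (RtoC x))))
                     (cosh_pow v c x))
      (Cmul (Cdiv (Cmul (two_pow v)
                        (Csub (Csub (Cpown vc 3) (Cmul (Cmul a a) vc)) (Cmul (Cmul b b) vc)))
                  P) S).
Proof.
  intros v2 c2 l1 l2 s3 s4 s5 s6 vc P Hv2 Hl1 Hl2 Hs3 Hs4 Hs5 Hs6.
  set (t := (Cone + Cone)%X).
  assert (Ht : t <> Czero) by (unfold t; rewrite <- RtoC_2; apply RtoC_neq0; lra).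
  assert (Hc0 : c <> Czero) by now apply Re_pos_neq0.
  set (z := (two_pow v / (t * t))%X).
  set (kappa := Cdiv (Cmul (two_pow v) _) P).
  set (A := (a / c2)%X); set (B := (b / c2)%X); set (Q := (s / c2)%X).
  assert (Ec2 : c2 = (t * c)%X) by (unfold c2; now rewrite RtoC_2).
  assert (Ev : v = (t * v2)%X)
    by (unfold v2; rewrite RtoC_2; fold t; field; exact Ht).
  assert (Hc2 : c2 <> Czero) by (rewrite Ec2; now apply Cmul_neq0).
  assert (Ea : a = (t * c * A)%X) by (rewrite <- Ec2; unfold A; field; exact Hc2).
  assert (Eb : b = (t * c * B)%X) by (rewrite <- Ec2; unfold B; field; exact Hc2).
  (* The square root enters through its square alone, so either choice of root serves. *)
  assert (EQ : (Q * Q)%X = (A * A + B * B)%X).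
  { unfold Q, A, B; transitivity (s * s / (c2 * c2))%X; [field; exact Hc2|].
    rewrite hs; field; exact Hc2. }
  assert (Hmu : forall m n, In m [vc + a + b; vc + a - b; vc - a + b; vc - a - b]%X ->
    (m + t * c * RtoC (INR n))%X <> Czero).
  { intros m n Hm; apply Re_pos_neq0; unfold t; pose proof (pos_INR n).
    assert (0 < Re m) by (destruct Hm as [<-|[<-|[<-|[<-|[]]]]]; assumption).
    cbn [Re Im Cadd Cmul RtoC Cone]; simpl; nra. }
  (* 2c(sigma_j + n) equals one of the four exponents plus 2cn, which has positive real part. *)
  assert (Hsn : forall n, (s3 + RtoC (INR n))%X <> Czero /\ (s4 + RtoC (INR n))%X <> Czero
    /\ (s5 + RtoC (INR n))%X <> Czero /\ (s6 + RtoC (INR n))%X <> Czero).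
  { intros n; repeat split; intros H.
    - apply (Hmu (vc - a - b)%X n); [simpl; auto|].
      transitivity (t * c * (s3 + RtoC (INR n)))%X; [|rewrite H; ring].
      unfold vc, s3; fold A B; rewrite Ev, Ea, Eb; ring.
    - apply (Hmu (vc - a + b)%X n); [simpl; auto|].
      transitivity (t * c * (s4 + RtoC (INR n)))%X; [|rewrite H; ring].
      unfold vc, s4; fold A B; rewrite Ev, Ea, Eb; ring.
    - apply (Hmu (vc + a + b)%X n); [simpl; auto|].
      transitivity (t * c * (s5 + RtoC (INR n)))%X; [|rewrite H; ring].
      unfold vc, s5; fold A B; rewrite Ev, Ea, Eb; ring.
    - apply (Hmu (vc + a - b)%X n); [simpl; auto|].
      transitivity (t * c * (s6 + RtoC (INR n)))%X; [|rewrite H; ring].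
      unfold vc, s6; fold A B; rewrite Ev, Ea, Eb; ring. }
  pose proof (not_nonpos_int_neq0 _ Hv2) as V0.
  pose proof (not_nonpos_int_neq0 _ Hl1) as L1.
  pose proof (not_nonpos_int_neq0 _ Hl2) as L2.
  assert (Hs0 : s3 <> Czero /\ s4 <> Czero /\ s5 <> Czero /\ s6 <> Czero).
  { destruct (Hsn 0%nat) as [K3 [K4 [K5 K6]]].
    assert (E0 : forall y, (y + RtoC (INR 0))%X = y)
      by (intros; replace (RtoC (INR 0)) with Czero by reflexivity; ring).
    rewrite !E0 in *; auto. }
  destruct Hs0 as [S3 [S4 [S5 S6]]].
  assert (ED : (v2 * v2 - (A * A + B * B))%X = (l1 * l2)%X)
    by (unfold l1, l2; fold Q; rewrite <- EQ; ring).
  assert (HD : (v2 * v2 - (A * A + B * B))%X <> Czero)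
    by (rewrite ED; now apply Cmul_neq0).
  set (ms := [vc + a + b; vc + a - b; vc - a + b; vc - a - b]%X) in *.
  (* Each hypergeometric term times the prefactor is the matching term of the integrated binomial
     series. *)
  assert (Hterm : forall n, (kappa * hyp_term
      [v; Cadd Cone v2; Cadd Cone l1; Cadd Cone l2; s3; s4; s5; s6]
      [v2; l1; l2; Cadd Cone s3; Cadd Cone s4; Cadd Cone s5; Cadd Cone s6]
      (RtoC (-1)) n)%X
    = (z * (nbinom v n * Clsum (fun m => / (m + RtoC 2 * c * RtoC (INR n))) ms))%X).
  { intros n; destruct (Hsn n) as [K3 [K4 [K5 K6]]].
    pose proof (partial_fractions v2 A B c (RtoC (INR n)) Ht Hc0 V0 HD
      S3 S4 S5 S6 K3 K4 K5 K6) as HPF.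
    cbv zeta in HPF; fold t in HPF.
    rewrite <- Ev, <- Ea, <- Eb in HPF; fold vc in HPF; fold A B in s3, s4, s5, s6.
    fold s3 s4 s5 s6 in HPF; fold P in HPF.
    rewrite hyp_term_shifted by assumption.
    set (k := RtoC (INR n)) in *.
    replace ((l1 + k) * (l2 + k) / (l1 * l2))%X with
      (((v2 + k) * (v2 + k) - (A * A + B * B)) / (v2 * v2 - (A * A + B * B)))%X.
    2: { rewrite ED; f_equal; unfold l1, l2; fold Q; rewrite <- EQ; ring. }
    assert (Ekappa : kappa
        = (two_pow v * ((vc * vc * vc - a * a * vc - b * b * vc) / P))%X).
    { unfold kappa, Cdiv; cbn [Cpown]; ring. }
    set (prod := (_ / v2 * _ * _)%X) in *.
    transitivity (two_pow v * nbinom v n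
      * ((vc * vc * vc - a * a * vc - b * b * vc) / P * prod))%X;
      [rewrite Ekappa; ring|].
    rewrite HPF; unfold z, ms, Clsum; cbn [fold_right]; rewrite RtoC_2; fold t.
    unfold Cdiv; ring. }
  (* kappa P = 2^v * 8c^3 * (v/2) lambda_1 lambda_2, a product of nonzero factors. This allows the
     series value to be recovered by division. *)
  assert (Hkappa : kappa <> Czero).
  { intros H; apply (Cmul_neq0 (two_pow v * (t * t * t * c * c * c)) (v2 * (l1 * l2)))%X.
    - repeat apply Cmul_neq0; try assumption; apply Cexp_neq0.
    - apply Cmul_neq0; [exact V0|]; now apply Cmul_neq0.
    - transitivity (kappa * P)%X; [|rewrite H; ring].
      unfold kappa; rewrite <- ED.
      assert (HP : P <> Czero).
      { unfold P; repeat apply Cmul_neq0; apply Re_pos_neq0; assumption. }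
      transitivity (two_pow v * (Cpown vc 3 - a * a * vc - b * b * vc))%X;
        [|field; exact HP].
      set (tp := two_pow v); unfold vc; rewrite Ev, Ea, Eb; cbn [Cpown]; ring. }
  destruct (improper_int_binomial v c z ms
    (fun x => Cdiv (Cmul (Ccosh (Cmul a (RtoC x))) (Ccosh (Cmul b (RtoC x))))
                   (cosh_pow v c x)) hv hc) as [L [[HL1 HL2] HI]].
  { intros m Hm; destruct Hm as [<-|[<-|[<-|[<-|[]]]]]; assumption. }
  { intros x; apply Cdiv_cosh_pow. }
  (* [L] is the value of the integral, so the prefactor times this witness is [L] again. *)
  exists (L / kappa)%X; split.
  - intros eps Heps.
    pose proof (Cnorm_pos _ Hkappa) as Hk.
    destruct (HL1 (eps * Cnorm kappa / 2)) as [N1 HN1]; [nra|].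
    destruct (HL2 (eps * Cnorm kappa / 2)) as [N2 HN2]; [nra|].
    exists (Nat.max N1 N2); intros n Hn.
    specialize (HN1 n ltac:(lia)); specialize (HN2 n ltac:(lia)).
    rewrite hyp_partial_Csum; set (H := Csum _ n).
    apply Rmult_lt_reg_l with (Cnorm kappa); [exact Hk|].
    rewrite <- Cnorm_mul.
    replace (kappa * (H - L / kappa))%X with (kappa * H - L)%X by (field; exact Hkappa).
    unfold H; rewrite <- Csum_scal, (Csum_ext _ _ n Hterm), Csum_scal.
    eapply Rle_lt_trans; [apply Cnorm_le_abs|].
    unfold Rdist in HN1, HN2; simpl in *; unfold Rminus in *; lra.
  - replace (kappa * (L / kappa))%X with L by (field; exact Hkappa); exact HI.
Qed.
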